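(* The nilCoxeter algebroid $\mathcal{D}$ is equal, as a subcategory of $\Bbbk$-vector spaces, to $\mathcal{D}'$ (that is, for all finitary $I,J\subset S$, the span of $\{\partial_p : p \text{ an } (I,J)\text{-coset}\}$ inside $\operatorname{Hom}_\Bbbk(R^J,R^I)$ equals the space of morphisms $J\to I$ in $\mathcal{D}'$). Thus $\mathcal{D}$ is well defined, i.e. closed under composition. The morphisms $\{\partial_p\}$, with $p$ ranging over all double cosets, form a basis for the morphisms in $\mathcal{D}$: for all finitary $I,J$, $\{\partial_p\}$ with $p$ ranging over all $(I,J)$-cosets is a basis of $\operatorname{Hom}_{\mathcal{D}}(J,I)$.
   Context: Let $(W,S)$ be a Coxeter system with length function $\ell$ and Coxeter matrix $(m_{st})$. For $I\subset S$, $W_I$ is the subgroup generated by $I$; $I$ is finitary if $W_I$ is finite, and then $w_I$ is its longest element. For $s\notin I$, $Is:=I\sqcup\{s\}$. Let $\Bbbk$ be a field. A realization is a finite-dimensional $\Bbbk$-vector space $V$ with roots $\alpha_s\in V$ and coroots $\alpha_s^\vee\in V^*$ ($s\in S$), $\langle\alpha_s^\vee,\alpha_s\rangle=2$, such that $s(v)=v-\langle\alpha_s^\vee,v\rangle\alpha_s$ defines an action of $W$ on $V$, and such that $[m_{st}]_s=[m_{st}]_t=0$ whenever $m_{st}<\infty$; here, with $a_{st}=\langle\alpha_s^\vee,\alpha_t\rangle$, $[0]_s=[0]_t=0$, $[1]_s=[1]_t=1$, $[2]_s=-a_{st}$, $[2]_t=-a_{ts}$, $[k+1]_s=[2]_s[k]_t-[k-1]_s$,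 $[k+1]_t=[2]_t[k]_s-[k-1]_t$. It is balanced if $[m_{st}-1]_s=[m_{st}-1]_t=1$ whenever $m_{st}<\infty$, and faithful if $W$ acts faithfully on $V$. Let $V$ be a faithful balanced realization satisfying generalized Demazure surjectivity (below). $R=\operatorname{Sym}(V)$, graded with $\deg V=2$; $R^I$ is the ring of $W_I$-invariants. $\partial_s\colon R\to R^s$, $\partial_s(f)=(f-s(f))/\alpha_s$; these satisfy $\partial_s^2=0$ and the braid relations, so $\partial_x:=\partial_{s_1}\cdots\partial_{s_d}$ is well defined for any reduced expression $x=s_1\cdots s_d$. Set $\partial_I:=\partial_{w_I}$ for $I$ finitary, and $\partial^I_J:=\partial_{w_Jw_I^{-1}}\colon R^I\to R^J$ for $I\subset J$ finitary. Generalized Demazure surjectivity: $\partial_I\colon R\to R^I$ is surjective for all finitary $I$. For $I,J$ finitary, an $(I,J)$-coset is an element $p\in W_I\backslash W/W_J$, regarded as a triple $(p,I,J)$; $\overline{p}$ is its maximal element in Bruhat order. $\partial_p:=\partial_{\overline{p}w_J^{-1}}$ restricted to a map $R^J\to R^I$. The nilCoxeter algebroid $\mathcal{D}$: objects are the finitary $I\subset S$ (associated with the vector space $R^I$); the morphisms $J\to I$ are the $\Bbbk$-linear combinations of the operators $\partial_p\colon R^J\to R^I$, $p$ an $(I,J)$-coset; composition is composition of functions. The category $\mathcal{D}'$: same objects; morphisms are all $\Bbbk$-linear combinations of compositions of the generating morphisms (whenever $s\notin I$ and $Is$ is finitary): $Is\to I$, the inclusion $R^{Is}\hookrightarrow R^I$;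 and $I\to Is$, the Demazure operator $\partial^I_{Is}\colon R^I\to R^{Is}$. *)

(* Defs.v *)
(* Conventions:
   - I, J, K : set S are sets of simple reflections, [s |` I] is Is;
   - the Coxeter matrix entry 0 stands for infinity;
   - Hom-sets are written source first, target second. *)
From HB Require Import structures.
From mathcomp Require Import all_boot all_order all_algebra.
From mathcomp Require Import mathcomp_extra boolp classical_sets functions.
From mathcomp Require Import cardinality.
From mathcomp Require Import mpoly.

Set Implicit Arguments.
Unset Strict Implicit.
Unset Printing Implicit Defensive.
Import GRing.Theory.
Local Open Scope classical_set_scope.
Local Open Scope ring_scope.

(* The congruence on the free monoid on S generated by (st)^(m s t) = 1. For a
   Coxeter matrix, m s s = 1 makes the generators involutions, so the quotient
   monoid is the group with this presentation. *)
Inductive coxeter_cong (S : Type) (m : S -> S -> nat) : seq S -> seq S -> Prop :=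
| cong_refl u : coxeter_cong m u u
| cong_sym u v : coxeter_cong m u v -> coxeter_cong m v u
| cong_trans v u w :
    coxeter_cong m u v -> coxeter_cong m v w -> coxeter_cong m u w
| cong_cat u u' v v' :
    coxeter_cong m u u' -> coxeter_cong m v v' ->
    coxeter_cong m (u ++ v) (u' ++ v')
| cong_rel s t : coxeter_cong m (flatten (nseq (m s t) [:: s; t])) [::].

Definition word_prod (W : groupType) (S : Type) (gen : S -> W) (u : seq S) : W :=
  foldr (fun s w => gen s * w)%g 1%g u.

Record coxeterSystem (W : groupType) (S : choiceType) := CoxeterSystem {
  gen : S -> W;
  cox_m : S -> S -> nat;
  cox_m_diag : forall s, cox_m s s = 1%N;
  cox_m_sym : forall s t, cox_m s t = cox_m t s;
  cox_m_off : forall s t, s <> t -> cox_m s t <> 1%N;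
  gen_generate : forall w, exists u, word_prod gen u = w;
  cox_presentation : forall u v,
    word_prod gen u = word_prod gen v <-> coxeter_cong cox_m u v
}.

Section CoxeterCombinatorics.
Context {W : groupType} {S : choiceType} (C : coxeterSystem W S).
Implicit Types (w x y t : W) (u : seq S) (I J : set S) (p : set W).

Definition len w : nat :=
  xget 0%N [set n | (exists u, word_prod (gen C) u = w /\ size u = n) /\
                    (forall u, word_prod (gen C) u = w -> (n <= size u)%N)].

Definition reduced_expr w u : Prop :=
  word_prod (gen C) u = w /\ size u = len w.

Definition is_subgroup (A : set W) : Prop :=
  A 1%g /\ forall x y, A x -> A y -> A (x * y^-1)%g.

Definition parabolic I : set W := smallest is_subgroup (gen C @` I).

Definition finitary I : Prop := finite_set (parabolic I).

Definition longest I : W :=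
  xget 1%g [set w | parabolic I w /\
                    forall x, parabolic I x -> (len x <= len w)%N].

Definition reflection t : Prop := exists w s, t = (w * gen C s * w^-1)%g.

Inductive bruhat_le : W -> W -> Prop :=
| bruhat_refl w : bruhat_le w w
| bruhat_step x y t :
    bruhat_le x y -> reflection t -> (len y < len (y * t)%g)%N ->
    bruhat_le x (y * t)%g.

Definition double_coset I w J : set W :=
  [set y | exists a b, [/\ parabolic I a, parabolic J b & y = (a * w * b)%g]].

Definition double_cosets I J : set (set W) :=
  [set p | exists w, p = double_coset I w J].

Definition coset_max p : W :=
  xget 1%g [set y | p y /\ forall x, p x -> bruhat_le x y].

End CoxeterCombinatorics.

(* Two-coloured quantum numbers: with x = [2]_s and y = [2]_t, [n]_s is
   [qnum x y n] and [n]_t is [qnum y x n]. *)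
Fixpoint qnum (k : pzRingType) (x y : k) (n : nat) : k :=
  match n with
  | 0 => 0
  | 1 => 1
  | (n2.+1 as n1).+1 => x * qnum y x n1 - qnum x y n2
  end.

Record realization (W : groupType) (S : choiceType) (C : coxeterSystem W S)
    (k : fieldType) (V : vectType k) := Realization {
  root : S -> V;
  coroot : S -> {linear V -> k^o};
  actV : W -> V -> V;
  coroot_root : forall s, coroot s (root s) = 2%:R;
  actV1 : forall v, actV 1%g v = v;
  actVM : forall w x v, actV (w * x)%g v = actV w (actV x v);
  actV_gen : forall s v, actV (gen C s) v = v - (coroot s v : k) *: root s;
  (* s <> t is implicit in the source: [m_ss] = [1] = 1 never vanishes *)
  qnum_m : forall s t, s <> t -> cox_m C s t <> 0%N ->
    qnum (- coroot s (root t) : k) (- coroot t (root s) : k) (cox_m C s t) = 0 /\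
    qnum (- coroot t (root s) : k) (- coroot s (root t) : k) (cox_m C s t) = 0
}.

Section Sym.
Context {k : fieldType} (V : vectType k).

(* Sym(V), as the polynomial ring on the chosen basis of V. *)
Definition symalg := {mpoly k[\dim {:V}]}.

Definition sym_inj (v : V) : symalg :=
  \sum_(i < \dim {:V}) coord (vbasis {:V}) i v *: 'X_i.

Definition sym_map (g : V -> V) (f : symalg) : symalg :=
  f \mPo [tuple sym_inj (g (vbasis {:V})`_i) | i < \dim {:V}].

End Sym.

Section Realization.
Context {W : groupType} {S : choiceType} {C : coxeterSystem W S}.
Context {k : fieldType} {V : vectType k} (r : realization C V).
Implicit Types (I J K : set S) (p : set W) (w : W) (s : S).

Definition balanced : Prop :=
  forall s t, s <> t -> cox_m C s t <> 0%N ->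
    qnum (- coroot r s (root r t) : k) (- coroot r t (root r s) : k)
      (cox_m C s t).-1 = 1 /\
    qnum (- coroot r t (root r s) : k) (- coroot r s (root r t) : k)
      (cox_m C s t).-1 = 1.

Definition faithful_realization : Prop :=
  forall w, (forall v, actV r w v = v) -> w = 1%g.

Definition actR w (f : symalg V) : symalg V := sym_map (actV r w) f.

Definition invariant I : {pred symalg V} :=
  fun f => `[< forall w, parabolic C I w -> actR w f = f >].

Fact invariant_submod I : submod_closed (invariant I).
Proof.
split=> [|a f g /asboolP If /asboolP Ig]; apply/asboolP => w Iw.
  exact: raddf0.
by rewrite /actR /sym_map linearP /= -!/(sym_map _ _) -!/(actR w _) If // Ig.
Qed.

HB.instance Definition _ I :=
  GRing.isSubmodClosed.Build k (symalg V) (invariant I) (invariant_submod I).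

(* R^I *)
Record invR I := InvR { inv_val : symalg V; _ : inv_val \in invariant I }.

HB.instance Definition _ I := [isSub for @inv_val I].
HB.instance Definition _ I := [Choice of invR I by <:].
HB.instance Definition _ I := [SubChoice_isSubLmodule of invR I by <:].

(* The quotient (f - s f) / alpha_s; it exists, and is unique as soon as
   alpha_s != 0, which holds for a faithful realization. *)
Definition demazure_s s (f : symalg V) : symalg V :=
  xget 0 [set g | sym_inj (root r s) * g = f - actR (gen C s) f].

Definition demazure_word (u : seq S) : symalg V -> symalg V :=
  foldr (fun s D => demazure_s s \o D) idfun u.

(* By the braid relations the chosen reduced expression is irrelevant. *)
Definition demazure w : symalg V -> symalg V :=
  demazure_word (xget [::] (reduced_expr C w)).

Definition demazure_surjective : Prop :=
  forall I, finitary C I ->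
  forall f, f \in invariant I -> exists g, demazure (longest C I) g = f.

(* phi : R^J -> R^I is the restriction of the operator D on R. *)
Definition restricts J I (D : symalg V -> symalg V) (phi : invR J -> invR I) : Prop :=
  forall f, inv_val (phi f) = D (inv_val f).

(* Linear span in an lmodType; used for the space of functions R^J -> R^I. *)
Definition lin_span (E : lmodType k) (A : set E) : set E :=
  [set e | exists n (c : 'I_n -> k) (a : 'I_n -> E),
    (forall i, A (a i)) /\ e = \sum_(i < n) c i *: a i].

Definition lin_free (T : Type) (E : lmodType k) (P : set T) (b : T -> E) : Prop :=
  forall n (p : 'I_n -> T) (c : 'I_n -> k),
    injective p -> (forall i, P (p i)) ->
    \sum_(i < n) c i *: b (p i) = 0 -> forall i, c i = 0.

Definition is_basis (T : Type) (E : lmodType k) (P : set T) (b : T -> E)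
    (A : set E) : Prop :=
  lin_free P b /\ lin_span (b @` P) = A.

(* The operator on R whose restriction to R^J -> R^I is partial_p, for an
   (I,J)-coset p. *)
Definition demazure_coset J p : symalg V -> symalg V :=
  demazure (coset_max C p * (longest C J)^-1)%g.

Definition nilCoxeter_hom J I : set (invR J -> invR I) :=
  lin_span [set phi | exists2 p,
    double_cosets C I J p & restricts (demazure_coset J p) phi].

Inductive elementary : forall J I, (invR J -> invR I) -> Prop :=
| elem_incl I s (phi : invR (s |` I) -> invR I) :
    ~ I s -> finitary C (s |` I) -> restricts idfun phi -> elementary phi
| elem_demazure I s (phi : invR I -> invR (s |` I)) :
    ~ I s -> finitary C (s |` I) ->
    restricts (demazure (longest C (s |` I) * (longest C I)^-1)%g) phi ->
    elementary phi.

Inductive elementary_comp J : forall I, (invR J -> invR I) -> Prop :=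
| ecomp_id : elementary_comp (@idfun (invR J))
| ecomp_step K I (phi : invR J -> invR K) (psi : invR K -> invR I) :
    elementary_comp phi -> elementary psi -> elementary_comp (psi \o phi).

Definition nilCoxeter'_hom J I : set (invR J -> invR I) :=
  lin_span [set phi | elementary_comp phi].

End Realization.

Arguments nilCoxeter_hom {W S C k V} r J I _.
Arguments nilCoxeter'_hom {W S C k V} r J I _.

(* Main.v *)
(* Let x be the maximal element of an (I,J)-coset p. Since R^J = d_J(R) and
   d_p d_J = d_x, the operators d_p inherit their linear independence from the
   d_x, which are independent because d_x is triangular with respect to the
   pairwise distinct automorphisms w of Sym(V) (Dedekind).
   Composing d_p with an inclusion gives the operator of the same x, and
   composing it with the Demazure operator from K to Ks gives, after
   precomposition with d_J, the product of d_(w_Ks w_K^-1) and d_x; so it is either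
   zero or the operator of the element w_Ks w_K^-1 x, which is again maximal.
   Conversely, d_p factors through generators: either x has a left descent
   outside I, and d_p factors through an inclusion; or I is the left descent set
   of x, and then for a suitable s in I a factor w_I w_(I-s)^-1 splits off on
   the left of x, leaving a maximal element of a smaller coset. *)
Require Import Defs.
From HB Require Import structures.
From mathcomp Require Import all_boot all_order all_algebra.
From mathcomp Require Import algC cyclotomic.
From mathcomp Require Import mathcomp_extra boolp classical_sets functions.
From mathcomp Require Import cardinality.
From mathcomp Require Import mpoly.
From mathcomp Require Import zify ring.

Set Implicit Arguments.
Unset Strict Implicit.
Unset Printing Implicit Defensive.
Import GRing.Theory.
Local Open Scope classical_set_scope.
Local Open Scope ring_scope.

(** * Words and the exchange condition *)

(** Coxeter theory is derived from the presentation alone: a function on words that respects the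
    relators descends to [W]. The parity of reflection occurrences is such a function and yields the
    exchange condition. The presentation shows at once only that the order of st divides [m s t];
    equality is what fixes the length of dihedral longest words in Matsumoto's theorem. It is proved
    in an auxiliary representation over [algC], since the field [k] of the realization is arbitrary.
    Matsumoto's theorem is needed because [demazure w] is built from an arbitrarily chosen reduced
    word; balancedness enters in the braid relations for the operators. Maximal elements of cosets
    are handled through their descents on both sides, and Deodhar's lemma shows that these determine
    them. The delicate point of the factorization is that the remaining factor must keep all of [J]
    as right descents: a badly chosen s in [I] can lose one. *)

Section Words.
Context {W : groupType} {S : choiceType} (C : coxeterSystem W S).
Implicit Types (w x y a b : W) (u v : seq S) (s t : S).
Local Notation g := (gen C).
Local Notation ev := (word_prod (gen C)).
Local Notation ell := (len C).
Local Open Scope nat_scope.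

Lemma word_prod_cat u v : ev (u ++ v) = (ev u * ev v)%g.
Proof. by elim: u => [|s u IH] /=; rewrite ?mul1g // IH mulgA. Qed.

Lemma gen2 s : (g s * g s = 1)%g.
Proof.
have /(cox_presentation C) := cong_rel (cox_m C) s s.
by rewrite cox_m_diag /= mulg1.
Qed.

Lemma genV s : ((g s)^-1 = g s)%g.
Proof. exact/mulg1_eq/gen2. Qed.

Lemma genK s : cancel (fun w => g s * w)%g (fun w => g s * w)%g.
Proof. by move=> w; rewrite mulgA gen2 mul1g. Qed.

Lemma word_prod_rev u : ev (rev u) = (ev u)^-1%g.
Proof.
elim: u => [|s u IH] /=; first by rewrite invg1.
by rewrite rev_cons -cats1 word_prod_cat IH /= mulg1 invgM genV.
Qed.

Fixpoint alt (s t : S) (n : nat) : seq S :=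
  if n is n'.+1 then s :: alt t s n' else [::].

Lemma size_alt s t n : size (alt s t n) = n.
Proof. by elim: n s t => //= n IH s t; rewrite IH. Qed.

Lemma alt_relator s t n : flatten (nseq n [:: s; t]) = alt s t n.*2.
Proof. by elim: n => //= n ->. Qed.

Lemma word_prod_alt s t n : ev (alt s t n.*2) = ((g s * g t) ^+ n)%g.
Proof. by elim: n => [|n IH] /=; rewrite ?expg0 // IH expgS mulgA. Qed.

Lemma gen_relator s t : ((g s * g t) ^+ cox_m C s t = 1)%g.
Proof.
have /(cox_presentation C) := cong_rel (cox_m C) s t.
by rewrite alt_relator word_prod_alt.
Qed.

(* The parity of the number of occurrences of [x] among the reflections
   s_1 ... s_(i-1) s_i s_(i-1) ... s_1 attached to the word s_1 ... s_k. *)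
Fixpoint refl_parity u x : bool :=
  if u is s :: u' then (x == g s) (+) refl_parity u' (g s * x * g s)%g
  else false.

Lemma refl_parity_cat u v x :
  refl_parity (u ++ v) x = refl_parity u x (+) refl_parity v ((ev u)^-1 * x * ev u)%g.
Proof.
elim: u x => [|s u IH] x /=; first by rewrite invg1 mul1g mulg1.
by rewrite IH addbA invgM genV !mulgA.
Qed.

Lemma refl_parity_alt s t n x :
  refl_parity (alt s t n) x =
  \big[addb/false]_(i < n) (x == ((g s * g t) ^+ i * g s))%g.
Proof.
elim: n s t x => [|n IH] s t x; first by rewrite big_ord0.
rewrite /= IH big_ord_recl /= expg0 mul1g; congr addb.
apply: eq_bigr => i _; rewrite /bump /= add1n.
have -> : ((g s * g t) ^+ i.+1 * g s = g s * ((g t * g s) ^+ i * g t) * g s)%g.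
  congr (_ * _)%g; elim: (nat_of_ord i) => [|j IHj]; first by rewrite expg1 expg0 mul1g.
  by rewrite expgS IHj expgS !mulgA.
have sandwich y : (g s * (g s * y * g s) * g s = y)%g by rewrite -!mulgA gen2 mulg1 (genK s y).
by apply/eqP/eqP => [<-|->]; rewrite sandwich.
Qed.

(** The reflections of the relator are (st)^i s for i < 2m. Since (st)^m = 1, the second half
    repeats the first, so each one occurs an even number of times. *)
Lemma refl_parity_relator s t x : refl_parity (flatten (nseq (cox_m C s t) [:: s; t])) x = false.
Proof.
rewrite alt_relator refl_parity_alt -addnn big_split_ord /=.
rewrite [X in _ (+) X](_ : _ = \big[addb/false]_(i < cox_m C s t) (x == (g s * g t) ^+ i * g s)%g).
  exact: addbb.
by apply: eq_bigr => i _; rewrite expgnDr gen_relator mul1g.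
Qed.

Lemma refl_parity_cong u v : coxeter_cong (cox_m C) u v -> forall x, refl_parity u x = refl_parity v x.
Proof.
elim=> {u v} [u|u v _ IH|v u w _ IH1 _ IH2|u u' v v' uu' IH1 _ IH2|s t] x //.
- by rewrite IH1.
- rewrite !refl_parity_cat IH1 IH2.
  by have /(cox_presentation C) -> := uu'.
- by rewrite refl_parity_relator.
Qed.

Lemma refl_parity_eq u v x : ev u = ev v -> refl_parity u x = refl_parity v x.
Proof. by move/(cox_presentation C)/refl_parity_cong. Qed.

Lemma odd_size_eq u v : ev u = ev v -> odd (size u) = odd (size v).
Proof.
move/(cox_presentation C); elim=> {u v} [u|u v _ IH|v u w _ IH1 _ IH2|u u' v v' uu' IH1 _ IH2|s t] //.
- by rewrite IH1.
- by rewrite !size_cat !oddD IH1 IH2.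
- by rewrite alt_relator size_alt odd_double.
Qed.

(** An odd count gives an occurrence, and multiplying by the reflection attached to a position
    cancels exactly the letter there. *)
Lemma refl_delete u x : refl_parity u x ->
  exists u', [/\ (x * ev u = ev u')%g, size u = (size u').+1 & subseq u' u].
Proof.
elim: u x => [|s u IH] x //=.
have [-> _|_ /= /IH[u' [e1 e2 e3]]] := eqVneq x (g s).
  by exists u; split; [rewrite genK| |exact: subseq_cons].
exists (s :: u'); split; rewrite /= ?e2 ?eqxx //.
by rewrite -e1 !mulgA gen2 mul1g.
Qed.

Lemma reduced_exists w : exists u, reduced_expr C w u.
Proof.
have [n [[u [uw un]] minn]] : exists n, (exists u, ev u = w /\ size u = n) /\
    (forall u, ev u = w -> n <= size u).
  have ex : exists n, `[< exists u, ev u = w /\ size u = n >].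
    by have [u uw] := gen_generate C w; exists (size u); apply/asboolP; exists u.
  have [n /asboolP nP nmin] := ex_minnP ex; exists n; split => // u uw.
  by apply: nmin; apply/asboolP; exists u.
exists u; split => //; rewrite un /len.
case: xgetP => [m _ /= [[v [vw vm]] minm]|/(_ n)/=].
  by apply/eqP; rewrite eqn_leq -{1}vm minn //= -un minm.
by move=> /not_andP; case; [case; exists u|].
Qed.

Lemma len_le_size u : ell (ev u) <= size u.
Proof.
rewrite /len; case: xgetP => [m _ /= [_]|_ //]; exact.
Qed.

Lemma odd_len u : odd (ell (ev u)) = odd (size u).
Proof. by have [v [/odd_size_eq <- ->]] := reduced_exists (ev u). Qed.

Lemma len1 : ell 1%g = 0.
Proof. by have := len_le_size [::]; rewrite /= leqn0 => /eqP. Qed.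

Lemma len_eq0 w : ell w = 0 -> w = 1%g.
Proof. by have [u [<- <-]] := reduced_exists w => /size0nil ->. Qed.

Lemma lenM a b : ell (a * b)%g <= ell a + ell b.
Proof.
have [u [<- <-]] := reduced_exists a; have [v [<- <-]] := reduced_exists b.
by rewrite -word_prod_cat -size_cat len_le_size.
Qed.

Lemma lenV w : ell (w^-1)%g = ell w.
Proof.
suff le x : ell (x^-1)%g <= ell x.
  by apply/eqP; rewrite eqn_leq le /= -{1}(invgK w) le.
have [u [<- <-]] := reduced_exists x.
by rewrite -word_prod_rev -(size_rev u) len_le_size.
Qed.

Lemma len_gen s : ell (g s) = 1.
Proof.
have := len_le_size [:: s]; have := odd_len [:: s]; rewrite /= mulg1.
by case: (ell (g s)) => [|[|]].
Qed.

Lemma odd_len_gen s w : odd (ell (g s * w)%g) = ~~ odd (ell w).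
Proof. by have [u <-] := gen_generate C w; rewrite odd_len (odd_len (s :: u)). Qed.

Lemma len_genE s w :
  if ell w < ell (g s * w)%g then ell (g s * w)%g = (ell w).+1
  else ell w = (ell (g s * w)%g).+1.
Proof.
have := lenM (g s) w; have := lenM (g s) (g s * w)%g; rewrite genK len_gen.
by have := odd_len_gen s w; case: ifP; lia.
Qed.

Lemma len_up s w : ell w < ell (g s * w)%g -> ell (g s * w)%g = (ell w).+1.
Proof. by have := len_genE s w; case: ifP. Qed.

Lemma len_down s w : ell (g s * w)%g < ell w -> ell w = (ell (g s * w)%g).+1.
Proof. by have := len_genE s w; case: ifP => //; lia. Qed.

Lemma len_updown s w : (ell w < ell (g s * w)%g) = ~~ (ell (g s * w)%g < ell w).
Proof. have := len_genE s w; case: ifP; lia. Qed.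

(** Odd parity passes to a reduced word, which deletion then shortens. If the parity is even,
    prepending [s] flips it, and the odd case applies to [s :: u]. *)
Lemma refl_parity_len s u : refl_parity u (g s) = (ell (g s * ev u)%g < ell (ev u)).
Proof.
have par v : refl_parity v (g s) -> ell (g s * ev v)%g < ell (ev v).
  move=> pv; have [v0 [v0E v0s]] := reduced_exists (ev v).
  have [|v' [e1 e2 _]] := @refl_delete v0 (g s); first by rewrite (refl_parity_eq _ v0E).
  by rewrite -v0s e2 ltnS -v0E e1 len_le_size.
case pu: (refl_parity u (g s)); first by rewrite par.
apply/esym/negbTE; rewrite -len_updown.
have := par (s :: u); rewrite /= eqxx gen2 mul1g pu /= genK; exact.
Qed.

Lemma exchange s u : ell (g s * ev u)%g < ell (ev u) ->
  exists u', [/\ (g s * ev u = ev u')%g, size u = (size u').+1 & subseq u' u].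
Proof. by rewrite -refl_parity_len => /refl_delete. Qed.

(** Parities add along a concatenation and a word of [a] contributes an even one, so the deleted
    letter lies in [v]. *)
Lemma exchange_word s a v : ell a < ell (g s * a)%g ->
  ell (g s * (a * ev v))%g < ell (a * ev v)%g ->
  exists v', [/\ (a^-1 * g s * a * ev v = ev v')%g, size v = (size v').+1 & subseq v' v].
Proof.
have [u [<- _]] := reduced_exists a.
rewrite -word_prod_cat -refl_parity_len refl_parity_cat len_updown -refl_parity_len.
by move=> /negbTE -> /= /refl_delete.
Qed.

Lemma exchange_mul s a b : ell a < ell (g s * a)%g ->
  ell (g s * (a * b))%g < ell (a * b)%g ->
  ell (a^-1 * g s * a * b)%g < ell b.
Proof.
have [v [<- <-]] := reduced_exists b => sa /(exchange_word sa)[v' [-> -> _]].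
by rewrite ltnS len_le_size.
Qed.

Lemma leftdesc_ex w : w <> 1%g -> exists s, ell (g s * w)%g < ell w.
Proof.
move=> w1; have [[|s u] [uE us]] := reduced_exists w; first by case: w1; rewrite -uE.
by exists s; rewrite -us -uE /= genK ltnS len_le_size.
Qed.

End Words.

(** * The order of a product of two simple reflections *)

(* A reflection representation of [W] on the functions [S -> algC] in which
   [st] has order exactly [m s t]; only the values of -2 cos (pi / m) matter, so
   they are replaced by -(z + 1/z) with z a primitive 2m-th root of unity, or
   z = 2 when m = 0 stands for infinity. *)
Section GenOrder.
Context {W : groupType} {S : choiceType} (C : coxeterSystem W S).
Implicit Types (s t : S) (f : S -> algC).
Local Notation g := (gen C).
Local Notation ev := (word_prod (gen C)).

Definition cox_zeta (m : nat) : algC :=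
  if m is m'.+1 then sval (C_prim_root_exists (isT : (0 < m'.+1.*2)%N)) else 2%:R.

Lemma cox_zetaP m : (m.+1.*2).-primitive_root (cox_zeta m.+1).
Proof. by rewrite /cox_zeta; case: C_prim_root_exists. Qed.

Lemma cox_zeta_neq0 m : cox_zeta m != 0.
Proof.
case: m => [|m]; first by rewrite /cox_zeta Num.Theory.pnatr_eq0.
by have := prim_root_eq0 (cox_zetaP m) => ->.
Qed.

Local Arguments cox_zeta : simpl never.

Definition cox_coef s t : algC :=
  - (cox_zeta (cox_m C s t) + (cox_zeta (cox_m C s t))^-1).

(** The contragredient reflection action: [f] is a linear form given by its values on the simple
    roots, and [s] subtracts [cox_coef s u] times the root of [s] from the root of [u]. *)
Definition cox_refl s f : S -> algC := fun u => f u - cox_coef s u * f s.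

Lemma cox_coef_sym s t : cox_coef s t = cox_coef t s.
Proof. by rewrite /cox_coef cox_m_sym. Qed.

Lemma cox_coef_diag s : cox_coef s s = 2%:R.
Proof.
rewrite /cox_coef cox_m_diag; have z2 : 2.-primitive_root (cox_zeta 1) := cox_zetaP 0.
have -> : cox_zeta 1 = -1.
  have /eqP := prim_expr_order z2; rewrite sqrf_eq1 => /orP[/eqP z1|/eqP//].
  by have := prim_order_dvd z2 1; rewrite expr1 z1 eqxx dvdn1.
by rewrite invrN1 -opprD opprK.
Qed.

(** On the values at [t] and [s], the product st has eigenvalues z^2 and z^-2, with eigencoordinates
    [A] and [B]. Any other value changes by multiples of the values met on the way, hence the
    geometric sums. *)
Lemma cox_refl_alt s t f (A B : algC) n : let z := cox_zeta (cox_m C s t) in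
  f t = A + B -> f s = - (A / z + B * z) ->
  let h := foldr cox_refl f (alt s t n.*2) in
  [/\ h t = A * z ^+ n.*2 + B * z^-1 ^+ n.*2,
      h s = - (A * z ^+ n.*2 / z + B * z^-1 ^+ n.*2 * z) &
      forall u, h u = f u
        - cox_coef t u * \sum_(i < n) (A * z ^+ i.*2 + B * z^-1 ^+ i.*2)
        - cox_coef s u * \sum_(i < n) (A * z ^+ i.*2.+1 + B * z^-1 ^+ i.*2.+1)].
Proof.
move=> z ft fs; have z0 : z != 0 by apply: cox_zeta_neq0.
elim: n => [|n [IHt IHs IH]]; rewrite ?doubleS /=.
  by split=> [||u]; rewrite ?expr0 ?mulr1 // !big_ord0 !mulr0 !subr0.
have cst : cox_coef s t = - (z + z^-1) by [].
set h := foldr _ _ _ in IHt IHs IH *.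
split=> [||u].
- rewrite /cox_refl !cox_coef_diag (cox_coef_sym t s) cst IHt IHs !exprS !exprVn.
  by field; rewrite ?expf_neq0.
- rewrite /cox_refl !cox_coef_diag (cox_coef_sym t s) cst IHt IHs !exprS !exprVn.
  by field; rewrite ?expf_neq0.
- rewrite /cox_refl (cox_coef_sym t s) cst IH IHt IHs !big_ord_recr /= !exprS !exprVn.
  by field; rewrite ?expf_neq0.
Qed.

(** For m > 1, z^2 is a primitive m-th root of unity, so the geometric sums of [cox_refl_alt] vanish
    over a full period. For m = 0 the word is empty. *)
Lemma cox_refl_alt_m s t f : foldr cox_refl f (alt s t (cox_m C s t).*2) = f.
Proof.
have [<-|nst] := pselect (s = t).
  rewrite cox_m_diag /=; apply/funext => u; rewrite /cox_refl cox_coef_diag; ring.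
set z := cox_zeta (cox_m C s t); have z0 : z != 0 by apply: cox_zeta_neq0.
case mE: (cox_m C s t) => [|m] //.
have m0 : m != 0%N by apply/eqP => m0; case: (@cox_m_off _ _ C s t nst); rewrite mE m0.
have zP : (m.+1.*2).-primitive_root z by rewrite /z mE; apply: cox_zetaP.
have z2P : (m.+1).-primitive_root (z ^+ 2).
  by have := exp_prim_root zP 2; rewrite -muln2 gcdnMl mulnK.
have z21 : z ^+ 2 != 1 by rewrite -[_ ^+ 2]expr1 -(prim_order_dvd z2P) dvdn1 eqSS.
have sum0 (y : algC) : y != 1 -> y ^+ m.+1 = 1 -> \sum_(i < m.+1) y ^+ i = 0.
  move=> y1 ym; have := subrX1 y m.+1; rewrite ym subrr => /esym/eqP.
  by rewrite mulf_eq0 subr_eq0 (negbTE y1) => /eqP.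
have sumz : \sum_(i < m.+1) (z ^+ 2) ^+ i = 0 := sum0 _ z21 (prim_expr_order z2P).
have sumV : \sum_(i < m.+1) (z^-1 ^+ 2) ^+ i = 0.
  by apply: sum0; rewrite exprVn ?invr_eq1 // exprVn (prim_expr_order z2P) invr1.
(* Solution of the linear system for [A] and [B]; its determinant z - 1/z is nonzero because z^2 is
   not 1. *)
pose B := - (f s + f t / z) / (z - z^-1); pose A := f t - B.
have ft : f t = A + B by rewrite subrK.
have fs : f s = - (A / z + B * z).
  by rewrite /A /B; field; rewrite z0 -expr2 subr_eq0 z21.
have [_ _ H] := cox_refl_alt m.+1 ft fs.
apply/funext => u; rewrite H -/z !big_split /= -!mulr_sumr.
have even (y : algC) : \sum_(i < m.+1) y ^+ i.*2 = \sum_(i < m.+1) (y ^+ 2) ^+ i.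
  by apply: eq_bigr => i _; rewrite -exprM mul2n.
have odd_sum (y : algC) : \sum_(i < m.+1) y ^+ i.*2.+1 = y * \sum_(i < m.+1) (y ^+ 2) ^+ i.
  by rewrite mulr_sumr; apply: eq_bigr => i _; rewrite exprS -exprM mul2n.
by rewrite !even !odd_sum sumz sumV !mulr0 addr0 !mulr0 !subr0.
Qed.

Lemma cox_refl_cong (u v : seq S) : coxeter_cong (cox_m C) u v ->
  forall f, foldr cox_refl f u = foldr cox_refl f v.
Proof.
elim=> {u v} [u|u v _ IH|v u w _ IH1 _ IH2|u u' v v' uu' IH1 _ IH2|s t] f //.
- by rewrite IH1.
- by rewrite !foldr_cat IH1 IH2.
- by rewrite alt_relator cox_refl_alt_m.
Qed.

Lemma gen_order s t n : s <> t -> ((g s * g t) ^+ n = 1)%g -> (cox_m C s t %| n)%N.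
Proof.
move=> nst; rewrite -word_prod_alt => /(@cox_presentation _ _ C _ [::])/cox_refl_cong rel.
set z := cox_zeta (cox_m C s t); have z0 : z != 0 by apply: cox_zeta_neq0.
(* Eigencoordinates 1 and 1: then (st)^n = 1 forces z^(2n) + z^(-2n) = 2, hence z^(2n) = 1. *)
pose f : S -> algC := fun u => if u == t then 1 + 1 else - (1 / z + 1 * z).
have ft : f t = 1 + 1 by rewrite /f eqxx.
have fs : f s = - (1 / z + 1 * z) by rewrite /f ifN //; apply/eqP.
have [+ _ _] := cox_refl_alt n ft fs; rewrite rel /= ft -/z !mul1r exprVn => zn.
have {zn} : z ^+ n.*2 = 1.
  have zn0 : z ^+ n.*2 != 0 by rewrite expf_neq0.
  have : (z ^+ n.*2 - 1) ^+ 2 = 0.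
    transitivity (z ^+ n.*2 * (z ^+ n.*2 + (z ^+ n.*2)^-1 - (1 + 1))); first by field.
    by rewrite -zn subrr mulr0.
  by move/eqP; rewrite expf_eq0 /= subr_eq0 => /eqP.
(* For m = 0 the base 2 is not a root of unity, so n = 0, the only multiple of 0. *)
rewrite /z; case: (cox_m C s t) => [|m].
  case: n {rel} => // n; rewrite /cox_zeta -natrX => /eqP.
  by rewrite Num.Theory.pnatr_eq1 -[1%N](expn0 2) eqn_exp2l.
by move/eqP; rewrite -(prim_order_dvd (cox_zetaP m)) -!muln2 dvdn_pmul2r.
Qed.

Lemma gen_inj : injective g.
Proof.
move=> s t gst; have [//|nst] := pselect (s = t).
have := @gen_order s t 1 nst; rewrite expg1 gst gen2 => /(_ erefl).
by rewrite dvdn1 => /eqP/(cox_m_off nst).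
Qed.

End GenOrder.

(** * Parabolic subgroups and double cosets *)

Section Parabolic.
Context {W : groupType} {S : choiceType} (C : coxeterSystem W S).
Implicit Types (w x y a b c : W) (u v : seq S) (s t : S) (I J K : set S).
Local Notation g := (gen C).
Local Notation ev := (word_prod (gen C)).
Local Notation ell := (len C).
Local Notation par := (parabolic C).
Local Open Scope nat_scope.

Lemma parabolic_subgroup I : is_subgroup (par I).
Proof.
split=> [A [[] //]|x y xI yI A AI]; have [[A1 AM] _] := AI.
by apply: AM; [apply: xI|apply: yI].
Qed.

Lemma parabolic1 I : par I 1%g.
Proof. by case: (parabolic_subgroup I). Qed.

Lemma parabolicV I a : par I a -> par I a^-1%g.
Proof.
by move=> aI; rewrite -[_^-1%g]mul1g; apply: (parabolic_subgroup I).2 => //; apply: parabolic1.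
Qed.

Lemma parabolicM I a b : par I a -> par I b -> par I (a * b)%g.
Proof.
by move=> aI bI; rewrite -[b]invgK; apply: (parabolic_subgroup I).2 => //; apply: parabolicV.
Qed.

Lemma parabolic_gen I s : I s -> par I (g s).
Proof. by move=> Is A [_]; apply; exists s. Qed.

Lemma parabolic_word I a : par I a <-> exists u, ev u = a /\ forall s, s \in u -> I s.
Proof.
split; last first.
  case=> u [<-]; elim: u => [|s u IH] /= uI; first exact: parabolic1.
  apply: parabolicM; first by apply: parabolic_gen; apply: uI; rewrite mem_head.
  by apply: IH => t tu; apply: uI; rewrite inE tu orbT.
move/(_ [set a | exists u, ev u = a /\ forall s, s \in u -> I s]); apply; split.
  split; first by exists [::].
  move=> _ _ [u [<- uI]] [v [<- vI]]; exists (u ++ rev v).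
  rewrite word_prod_cat word_prod_rev; split=> // s.
  by rewrite mem_cat mem_rev => /orP[/uI|/vI].
move=> _ [s sI <-]; exists [:: s]; rewrite /= mulg1; split=> // t.
by rewrite inE => /eqP ->.
Qed.

Lemma parabolicS I J : I `<=` J -> par I `<=` par J.
Proof. by move=> IJ a /parabolic_word[u [<- uI]]; apply/parabolic_word; exists u; split=> // s /uI/IJ. Qed.

Lemma finitaryS I J : I `<=` J -> finitary C J -> finitary C I.
Proof. by move=> /parabolicS; apply: sub_finite_set. Qed.

(** Exchange only deletes letters, so a word over [I] shrinks to a reduced one over [I]. *)
Lemma parabolic_reduced I a : par I a -> exists u, reduced_expr C a u /\ forall s, s \in u -> I s.
Proof.
move=> /parabolic_word[u [<-]]; elim: u => [|s u IH] uI.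
  by exists [::]; split=> //; split; rewrite /= ?len1.
have sI : I s by apply: uI; rewrite mem_head.
have [|v [[vE vs] vI]] := IH; first by move=> t tu; apply: uI; rewrite inE tu orbT.
have := len_updown C s (ev u); case: ltnP => [lt _|_ /esym/negbFE lt].
  exists (s :: v); split; first by split; rewrite /= ?vE // vs (len_up lt).
  by move=> t; rewrite inE => /orP[/eqP ->|/vI].
have := lt; rewrite -{1 2}vE => /exchange[v' [e1 e2 e3]]; exists v'; split.
  split; first by rewrite -e1 vE.
  by apply/eqP; rewrite -eqSS -e2 vs (len_down lt).
by move=> t /(mem_subseq e3)/vI.
Qed.

Lemma parabolic_ind I (P : W -> Prop) : P 1%g ->
  (forall s a, I s -> par I a -> ell a < ell (g s * a)%g -> P a -> P (g s * a)%g) ->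
  forall a, par I a -> P a.
Proof.
move=> P1 PS a /parabolic_reduced[u]; elim: u a => [|s u IH] a [[<- us] uI] //.
have uI' t : t \in u -> I t by move=> tu; apply: uI; rewrite inE tu orbT.
have ulen : ell (ev u) = size u.
  have := lenM C (g s) (ev u); have := len_le_size C u.
  by rewrite len_gen -[(_ * _)%g]/(ev (s :: u)) -us /=; lia.
apply: PS; first by apply: uI; rewrite mem_head.
- by apply/parabolic_word; exists u.
- by rewrite ulen -[(_ * _)%g]/(ev (s :: u)) -us.
- by apply: IH; split=> //; split.
Qed.

Lemma parabolic_genE I s : par I (g s) -> I s.
Proof.
move=> /parabolic_reduced[[|t [|t' u]] [[]]]; rewrite len_gen //= mulg1.
by move=> /gen_inj -> _; apply; rewrite mem_head.
Qed.

Lemma parabolic_desc I s a : par I a -> ell (g s * a)%g < ell a -> I s.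
Proof.
move=> aI; have [u [[uE us] uI]] := parabolic_reduced aI.
rewrite -uE => /exchange[u' [e1 _ e3]]; apply: parabolic_genE.
rewrite -[g s](mulgK (ev u)) e1 uE; apply: parabolicM; last exact: parabolicV.
by apply/parabolic_word; exists u'; split=> // t /(mem_subseq e3)/uI.
Qed.

(** Maximality and minimality in W_I x are encoded by left descents; the right-handed versions are
    read on the inverse. *)
Definition lmax I x := forall s, I s -> ell (g s * x)%g < ell x.
Definition lmin I y := forall s, I s -> ell y < ell (g s * y)%g.

(** Take y shortest in W_I w. If s lengthened b but shortened b y, exchange would make b^-1 s b y,
    which lies in the same coset, shorter than y. *)
Lemma coset_decomp I w : exists a y, [/\ par I a, w = (a * y)%g, lmin I y &
  forall b, par I b -> ell (b * y)%g = ell b + ell y].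
Proof.
have ex : exists n, `[< exists2 a, par I a & ell (a * w)%g = n >].
  by exists (ell w); apply/asboolP; exists 1%g; rewrite ?mul1g //; apply: parabolic1.
have [n /asboolP[a aI an] nmin] := ex_minnP ex.
have ymin b : par I b -> ell (a * w)%g <= ell (b * (a * w))%g.
  move=> bI; rewrite an; apply: nmin; apply/asboolP.
  by exists (b * a)%g; [apply: parabolicM|rewrite mulgA].
exists a^-1%g, (a * w)%g; split.
- exact: parabolicV.
- by rewrite mulKg.
- move=> s sI; rewrite len_updown -leqNgt; apply: ymin; exact: parabolic_gen.
apply: parabolic_ind => [|s b sI bI sb IH]; first by rewrite mul1g len1.
rewrite -(mulgA (g s)) (len_up sb) addSn -IH; apply: len_up.
rewrite len_updown; apply/negP => /(exchange_mul sb).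
have := ymin (b^-1 * g s * b)%g; rewrite ltnNge => -> //.
by apply: parabolicM => //; apply: parabolicM; [apply: parabolicV|apply: parabolic_gen].
Qed.

(** Local minimality suffices: if y = b y' with y' shortest and b nontrivial, a left descent of b
    lies in [I] and is a descent of y. *)
Lemma lmin_len I y a : lmin I y -> par I a -> ell (a * y)%g = ell a + ell y.
Proof.
have [b [y' [bI -> _ add]]] := coset_decomp I y; move=> ymin.
have [->|b1] := pselect (b = 1%g); first by rewrite mul1g; apply: add.
have [s sb] := leftdesc_ex C b1; have sI := parabolic_desc bI sb.
have := ymin s sI; rewrite mulgA !add //; first by rewrite ltn_add2r ltnNge ltnW.
by apply: parabolicM => //; apply: parabolic_gen.
Qed.

Lemma lmin_unique I y y' a : lmin I y -> lmin I y' -> par I a -> y' = (a * y)%g -> y' = y.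
Proof.
move=> ymin y'min aI e; have := lmin_len ymin aI; rewrite -e.
have := lmin_len y'min (parabolicV aI); rewrite e mulKg lenV => e1 e2.
by rewrite (@len_eq0 _ _ C a) ?mul1g //; lia.
Qed.

(** Build [a] letter by letter: each new letter is a descent of x but not of the prefix built so
    far, so exchange removes a letter of the remaining subword of [u]. *)
Lemma lmax_word I x u a : lmax I x -> reduced_expr C x u -> par I a ->
  exists v, [/\ subseq v u, (a * ev v)%g = x & ell a + size v = ell x].
Proof.
move=> xmax [uE us]; elim/parabolic_ind: a / => [|s a sI aI sa [v [vu vE vs]]].
  by exists u; rewrite len1 mul1g.
have := xmax s sI; rewrite -vE => /(exchange_word sa)[v' [e1 e2 e3]].
exists v'; split; first exact: subseq_trans e3 vu.
  by rewrite -e1 !mulgA mulgK gen2 mul1g.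
by rewrite (len_up sa) vE -vs e2 addnS.
Qed.

Lemma lmax_len I x a : lmax I x -> par I a -> ell a + ell (a^-1 * x)%g = ell x.
Proof.
move=> xmax aI; have [u ux] := reduced_exists C x.
have [v [_ ve vs]] := lmax_word xmax ux aI; have := len_le_size C v.
by have := lenM C a (ev v); rewrite -ve mulKg ve; lia.
Qed.

(** By [lmax_word], every element of W_I is x times the inverse of a subword of one fixed word, and
    there are finitely many masks. *)
Lemma lmax_finitary I x : lmax I x -> finitary C I.
Proof.
move=> xmax; have [u ux] := reduced_exists C x.
apply: (@sub_finite_set _ _
  [set` [seq x * (ev (mask m u))^-1 | m : (size u).-tuple bool]%g]); last exact: finite_seq.
move=> a aI; have [v [/subseqP[m /eqP sm vm] ve _]] := lmax_word xmax ux aI.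
apply/mapP; exists (Tuple sm); first by rewrite mem_enum.
by rewrite /= -vm -ve mulgK.
Qed.

(** * Longest elements of finite parabolic subgroups *)

Section Longest.
Variable I : set S.
Hypothesis finI : finitary C I.
Local Notation wI := (longest C I).

Lemma longestP : par I wI /\ forall x, par I x -> ell x <= ell wI.
Proof.
rewrite /longest; case: xgetP => [w _ [] //|none].
have [l lE] := (finite_seqP _).1 finI.
have ex : exists n, `[< exists2 a, par I a & ell a = n >].
  by exists 0; apply/asboolP; exists 1%g; [apply: parabolic1|rewrite len1].
have bounded n : `[< exists2 a, par I a & ell a = n >] -> n <= \max_(a <- l) ell a.
  by move=> /asboolP[a aI <-]; apply: leq_bigmax_seq => //; rewrite lE in aI.
have [n /asboolP[a aI an] amax] := ex_maxnP ex bounded.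
by case: (none a); split=> // x xI; rewrite an; apply: amax; apply/asboolP; exists x.
Qed.

Lemma parabolic_longest : par I wI. Proof. by case: longestP. Qed.

Lemma lmax_longest : lmax I wI.
Proof.
move=> s sI; apply: contraT; rewrite -len_updown ltnNge => /negP[]; apply: longestP.2.
by apply: parabolicM; [apply: parabolic_gen|apply: parabolic_longest].
Qed.

Lemma longest_eq a : par I a -> ell wI <= ell a -> a = wI.
Proof.
move=> aI le; have := lmax_len lmax_longest aI => e.
by rewrite -[RHS](mulVKg a) (@len_eq0 _ _ C (a^-1 * wI)%g) ?mulg1 //; lia.
Qed.

Lemma longest_unique a : par I a -> lmax I a -> a = wI.
Proof.
move=> aI amax; apply: longest_eq => //.
by have := lmax_len amax parabolic_longest; lia.
Qed.

Lemma longestV : (wI^-1)%g = wI.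
Proof. by apply: longest_eq; rewrite ?lenV //; apply: parabolicV; apply: parabolic_longest. Qed.

Lemma longest2 : (wI * wI = 1)%g.
Proof. by rewrite -{1}longestV mulVg. Qed.

Lemma lmax_longestM y : lmin I y -> lmax I (wI * y)%g.
Proof.
move=> ymin s sI; have wP := parabolic_longest.
have swP := parabolicM (parabolic_gen sI) wP.
by rewrite mulgA !(lmin_len ymin) // ltn_add2r lmax_longest.
Qed.

Lemma lmin_longestM x : lmax I x -> lmin I (wI * x)%g.
Proof.
have [a [y [aI -> ymin _]]] := coset_decomp I x; move=> xmax.
rewrite (@longest_unique a) ?mulgA ?longest2 ?mul1g // => s sI.
have := xmax s sI; rewrite mulgA !(lmin_len ymin) ?ltn_add2r //.
by apply: parabolicM => //; apply: parabolic_gen.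
Qed.

Lemma len_longestM x : lmax I x -> ell x = ell wI + ell (wI * x)%g.
Proof.
move=> xmax; rewrite -(lmin_len (lmin_longestM xmax) parabolic_longest).
by rewrite mulgA longest2 mul1g.
Qed.

Lemma len_par_longest a : par I a -> ell a + ell (a * wI)%g = ell wI.
Proof. by move=> /parabolicV/(lmax_len lmax_longest); rewrite invgK lenV. Qed.

(** Multiplication by [wI] complements lengths within W_I; doing so on both sides of [s] restores
    length 1. *)
Lemma longest_conj s : I s -> exists2 t, I t & (wI * g s * wI = g t)%g.
Proof.
move=> sI; have sP := parabolic_gen sI; have wP := parabolic_longest.
have cP : par I (wI * g s * wI)%g by do 2!apply: parabolicM => //.
have := len_par_longest (parabolicM wP sP); have := len_par_longest sP.
rewrite len_gen -(lenV C (wI * g s)%g) invgM longestV genV => <- /eqP.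
rewrite addnC eqn_add2r => /eqP c1.
have [[|t [|t' u]] [[uE us] uI]] := parabolic_reduced cP; rewrite c1 // in us.
by exists t; [apply: uI; rewrite mem_head|rewrite -uE /= mulg1].
Qed.

End Longest.

(* Deodhar's lemma *)
Lemma lmin_gen I y t : lmin I y ->
  lmin I (y * g t)%g \/ exists2 s, I s & (y * g t = g s * y)%g.
Proof.
move=> ymin; have [|] := pselect (lmin I (y * g t)%g); first by left.
move=> /existsNP[s /not_implyP[sI /negP]]; rewrite len_updown negbK.
move=> /(exchange_mul (ymin s sI)); rewrite len_gen ltnS leqn0 => /eqP/len_eq0 e.
right; exists s => //; rewrite -(mulgK (g t) (g s * y)%g) genV; congr (_ * _)%g.
by apply: (mulgI y^-1%g); rewrite mulVg !mulgA e.
Qed.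

(** Iterates Deodhar's lemma over a word of [b]: each letter is either kept on the right or passes
    through as a letter of [I] on the left. *)
Lemma lmin_move I J y b : lmin I y -> par J b ->
  exists a b', [/\ par I a, par J b', (y * b = a * (y * b'))%g & lmin I (y * b')%g].
Proof.
move=> ymin /parabolic_word[u [<-]]; elim/last_ind: u => [|u t IH] uJ.
  by exists 1%g, 1%g; rewrite !mulg1 mul1g; split=> //; apply: parabolic1.
have [|a [c [aI cJ e cmin]]] := IH; first by move=> s su; apply: uJ; rewrite mem_rcons inE su orbT.
rewrite -cats1 word_prod_cat /= mulg1 mulgA e.
have [ct|[s sI ct]] := lmin_gen t cmin.
  exists a, (c * g t)%g; rewrite !mulgA in ct *; split=> //.
  by apply: parabolicM => //; apply: parabolic_gen; apply: uJ; rewrite mem_rcons mem_head.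
exists (a * g s)%g, c; split=> //; last by rewrite -mulgA ct !mulgA.
by apply: parabolicM => //; apply: parabolic_gen.
Qed.

Lemma double_coset_refl I J w : double_coset C I w J w.
Proof. by exists 1%g, 1%g; rewrite mul1g mulg1; split=> //; apply: parabolic1. Qed.

Lemma double_coset_eq I J w x : double_coset C I w J x ->
  double_coset C I w J = double_coset C I x J.
Proof.
move=> [a [b [aI bJ ->]]]; apply/seteqP; split=> _ [c [d [cI dJ ->]]].
  exists (c * a^-1)%g, (b^-1 * d)%g; split; first by apply: parabolicM => //; apply: parabolicV.
    by apply: parabolicM => //; apply: parabolicV.
  by rewrite !mulgA mulgVK -!mulgA mulVKg.
exists (c * a)%g, (b * d)%g; split; first exact: parabolicM.
  exact: parabolicM.
by rewrite !mulgA.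
Qed.

(** A descent criterion for the Bruhat maximum of a double coset; the agreement is
    [coset_max_dmax]. *)
Definition dmax I J x := lmax I x /\ lmax J x^-1%g.

(** Strip w_I on the left: [lmin_move] and uniqueness of minimal elements give x' in x W_J. The same
    uniqueness, applied to the inverses and [J], finishes. *)
Lemma dmax_unique I J x x' : dmax I J x -> dmax I J x' ->
  double_coset C I x J x' -> x' = x.
Proof.
move=> [xI xJ] [x'I x'J] [a [b [aI bJ e]]].
have fI := lmax_finitary xI; have fJ := lmax_finitary xJ.
have wP := parabolic_longest fI.
have [a' [b' [a'I b'J e' min']]] := lmin_move (lmin_longestM fI xI) bJ.
have e1 : (longest C I * x' = longest C I * x * b')%g.
  apply: (lmin_unique min' (lmin_longestM fI x'I)
    (a := (longest C I * a * longest C I * a')%g)).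
    by do 3!apply: parabolicM => //.
  rewrite e -(mulgA _ a') -e' !mulgA -(mulgA _ (longest C I) (longest C I)) longest2 //.
  by rewrite mulg1.
have {}e1 : (x' = x * b')%g by apply: (mulgI (longest C I)); rewrite e1 mulgA.
have wJP := parabolic_longest fJ.
have : (longest C J * x'^-1 = longest C J * x^-1)%g.
  apply: (lmin_unique (lmin_longestM fJ xJ) (lmin_longestM fJ x'J)
    (a := (longest C J * b'^-1 * longest C J)%g)).
    by do 2!apply: parabolicM => //; apply: parabolicV.
  by rewrite e1 invgM !mulgA -(mulgA _ (longest C J) (longest C J)) longest2 ?mulg1.
by move/mulgI/invg_inj.
Qed.

Lemma bruhat_le_trans x y w : bruhat_le C x y -> bruhat_le C y w -> bruhat_le C x w.
Proof.
move=> + yw; elim: yw => // {}y {}w t _ IH tr lt xy.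
by apply: bruhat_step => //; apply: IH.
Qed.

Lemma bruhat_le_len x y : bruhat_le C x y -> x = y \/ ell x < ell y.
Proof.
elim=> [w|{}x {}y t _ IH _ lt]; [by left|right].
by case: IH => [->//|h]; apply: ltn_trans lt.
Qed.

Lemma bruhat_genl s w : ell w < ell (g s * w)%g -> bruhat_le C w (g s * w)%g.
Proof.
move=> lt; have e : (g s * w = w * (w^-1 * g s * w^-1^-1))%g by rewrite invgK mulgA mulVKg.
rewrite e; apply: bruhat_step; first exact: bruhat_refl; last by rewrite -e.
by exists w^-1%g, s.
Qed.

Lemma bruhat_genr s w : ell w < ell (w * g s)%g -> bruhat_le C w (w * g s)%g.
Proof.
move=> lt; apply: bruhat_step => //; first exact: bruhat_refl.
by exists 1%g, s; rewrite invg1 mul1g mulg1.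
Qed.

(** A missing descent gives a step up in Bruhat order inside the double coset, whose lengths are
    bounded because [I] and [J] are finitary. *)
Lemma dmax_above I J w : finitary C I -> finitary C J ->
  exists x, [/\ dmax I J x, double_coset C I w J x & bruhat_le C w x].
Proof.
move=> fI fJ.
have [n bounded] : exists n, forall y, double_coset C I w J y -> ell y <= n.
  exists (ell (longest C I) + ell w + ell (longest C J)) => _ [a [b [aI bJ ->]]].
  have := (longestP fI).2 a aI; have := (longestP fJ).2 b bJ.
  by have := lenM C (a * w)%g b; have := lenM C a w; lia.
move: {2}(n - ell w) (leqnn (n - ell w)) => k; elim: k w bounded => [|k IH] w bounded le.
all: have [wmax|] := pselect (dmax I J w);
  first by exists w; split=> //; [apply: double_coset_refl|apply: bruhat_refl].
all: move=> /not_andP wmax.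
all: have [y [lt dy wy]] : exists y, [/\ ell w < ell y, double_coset C I w J y & bruhat_le C w y].
1,3: case: wmax => /existsNP[s /not_implyP[sI /negP]]; rewrite -len_updown => lt.
1,3: exists (g s * w)%g; split=> //; last exact: bruhat_genl.
1,2: by exists (g s), 1%g; rewrite mulg1; split=> //; [apply: parabolic_gen|apply: parabolic1].
1,2: rewrite lenV -[(_ * _)%g]invgK lenV invgM invgK genV in lt.
1,2: exists (w * g s)%g; split=> //; last exact: bruhat_genr.
1,2: by exists 1%g, (g s); rewrite mul1g; split=> //; [apply: parabolic1|apply: parabolic_gen].
  by have := bounded y dy; lia.
have [||x [xmax dx yx]] := IH y; last first.
- by exists x; split=> //; [rewrite (double_coset_eq dy)|apply: bruhat_le_trans yx].
- by lia.
- by move=> z; rewrite -(double_coset_eq dy); apply: bounded.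
Qed.

(** Every element climbs to some [dmax] element, which by uniqueness is x; lengths give antisymmetry
    of the Bruhat order. *)
Lemma coset_max_dmax I J x : dmax I J x -> coset_max C (double_coset C I x J) = x.
Proof.
move=> xmax; have fI := lmax_finitary xmax.1; have fJ := lmax_finitary xmax.2.
have above y : double_coset C I x J y -> bruhat_le C y x.
  move=> dy; have [x' [x'max dx' yx']] := dmax_above y fI fJ.
  by rewrite -(dmax_unique xmax x'max) // (double_coset_eq dy).
have xx := double_coset_refl I J x.
rewrite /coset_max; case: xgetP => [y _ /= [dy ymax]|/(_ x)]; last by case.
case: (bruhat_le_len (ymax x xx)) => // lt1.
by case: (bruhat_le_len (above y dy)) => //; lia.
Qed.

Lemma double_cosets_dmax I J p : finitary C I -> finitary C J -> double_cosets C I J p ->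
  exists2 x, dmax I J x & p = double_coset C I x J.
Proof.
move=> fI fJ [w ->]; have [x [xmax dx _]] := dmax_above w fI fJ.
by exists x => //; apply: double_coset_eq.
Qed.

(** * Alternating words and Matsumoto's theorem *)

Lemma alt_cat s t m n : alt s t (m + n) = alt s t m ++ if odd m then alt t s n else alt s t n.
Proof. by elim: m s t => //= m IH s t; rewrite IH; case: (odd m). Qed.

Lemma rev_alt s t n : rev (alt s t n) = if odd n then alt s t n else alt t s n.
Proof.
elim: n s t => //= n IH s t; rewrite rev_cons IH -cats1.
case on: (odd n) => /=.
  by rewrite -[RHS]/(alt t s n.+1) -addn1 alt_cat on.
by rewrite -[RHS]/(alt s t n.+1) -addn1 alt_cat on.
Qed.

Lemma alt_expg s t n : ((g s * g t) ^+ n = ev (alt s t n) * (ev (alt t s n))^-1)%g.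
Proof.
rewrite -word_prod_alt -addnn alt_cat word_prod_cat -word_prod_rev rev_alt.
by case: (odd n).
Qed.

Lemma braid s t : ev (alt s t (cox_m C s t)) = ev (alt t s (cox_m C s t)).
Proof. by apply: divg1_eq; rewrite -alt_expg gen_relator. Qed.

Lemma reduced_behead s u : reduced_expr C (ev (s :: u)) (s :: u) -> reduced_expr C (ev u) u.
Proof.
case=> _ /= us; split=> //; have := len_le_size C u; have := lenM C (g s) (ev u).
by rewrite len_gen -us; lia.
Qed.

Lemma reduced_alt s t u : reduced_expr C (ev u) u -> (forall r, r \in u -> r = s \/ r = t) ->
  u = alt s t (size u) \/ u = alt t s (size u).
Proof.
elim: u => [|r u IH] ru ust; first by left.
have {IH}uE : u = alt s t (size u) \/ u = alt t s (size u).
  by apply: IH; [apply: reduced_behead ru|move=> y yu; apply: ust; rewrite inE yu orbT].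
have nred v : u <> r :: v.
  by move=> e; move: ru.2; rewrite e /= genK; have := len_le_size C v; lia.
have rst := ust r (mem_head _ _); rewrite /=.
move: (size u) uE nred => n; case: rst => -> [] ->; [|by move=> _; left|by move=> _; right|].
  by case: n => [|n] nred; [left|case: (nred (alt t s n))].
by case: n => [|n] nred; [right|case: (nred (alt s t n))].
Qed.

(** The longest element of the dihedral subgroup has alternating reduced words starting with either
    letter. Their equality makes m divide its length by [gen_order], and longer alternating words
    are not reduced. *)
Lemma two_descents s t w : s <> t -> ell (g s * w)%g < ell w -> ell (g t * w)%g < ell w ->
  0 < cox_m C s t /\ exists x, w = (ev (alt s t (cox_m C s t)) * x)%g /\ ell w = cox_m C s t + ell x.
Proof.
move=> nst ws wt; pose I := [set s; t].
have wmax : lmax I w by move=> _ [] ->.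
have fI := lmax_finitary wmax; have aI := parabolic_longest fI.
have amax := lmax_longest fI; have wE := len_longestM fI wmax.
set a := longest C I in aI amax wE.
have first_letter r : I r -> exists u, reduced_expr C a (r :: u) /\ forall q, q \in u -> I q.
  move=> rI; have rP := parabolic_gen rI.
  have [u [[uE us] uI]] := parabolic_reduced (parabolicM rP aI).
  exists u; split=> //; split; rewrite /= ?uE ?genK // us.
  by rewrite -len_down // amax.
have alt_first r q : I r -> I q -> r <> q -> ev (alt r q (ell a)) = a.
  move=> rI qI rq; have [u [ru uI]] := first_letter r rI.
  have [|z|e|e] := @reduced_alt r q (r :: u); first by rewrite ru.1.
  - rewrite inE => /predU1P[->|/uI zI]; first by left.
    by move: rI qI rq zI => [] -> [] -> // _ [] ->; auto.
  - by rewrite -ru.2 -e ru.1.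
  - by move: e => /= -[] /rq.
have sI : I s by left. have tI : I t by right.
have m_dvd : (cox_m C s t %| ell a).
  apply: gen_order => //; rewrite alt_expg !alt_first ?mulgV //.
  by move=> ts; apply: nst.
have a0 : 0 < ell a by apply: leq_ltn_trans (amax s sI).
have m0 : 0 < cox_m C s t by apply: dvdn_gt0 m_dvd.
have le_m : ell a <= cox_m C s t.
  rewrite leqNgt; apply/negP => lt; have := alt_first s t sI tI nst.
  (* The m letters after the initial [s] may be replaced by the alternating word that starts with
     [s]; the two [s] cancel, so the length drops below [ell a]. *)
  rewrite -{1}(subnKC lt) alt_cat word_prod_cat /= -braid => aE.
  set v := (if _ then _ else _) in aE.
  have vs : size v = ell a - (cox_m C s t).+1 by rewrite /v; case: ifP; rewrite size_alt.
  have := lenM C (g s * ev (alt s t (cox_m C s t)))%g (ev v); rewrite aE.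
  have := len_le_size C v; rewrite vs; move: lt.
  case: (cox_m C s t) m0 => // m _; rewrite /= genK => lt.
  by have := len_le_size C (alt t s m); rewrite size_alt; lia.
have mE : ell a = cox_m C s t by apply/eqP; rewrite eqn_leq le_m dvdn_leq.
split=> //; exists (a * w)%g; rewrite -mE alt_first //; split; last by [].
by rewrite mulgA (longest2 fI) mul1g.
Qed.

(** If the first letters differ, both are descents of [w], and [two_descents] supplies reduced words
    with the two alternating prefixes; each shares its first letter with one of the given words, so
    induction applies to the tails. *)
Lemma matsumoto (T : Type) (F : seq S -> T) :
  (forall s u v, F u = F v -> F (s :: u) = F (s :: v)) ->
  (forall s t u, s <> t -> 0 < cox_m C s t ->
     F (alt s t (cox_m C s t) ++ u) = F (alt t s (cox_m C s t) ++ u)) ->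
  forall w u v, reduced_expr C w u -> reduced_expr C w v -> F u = F v.
Proof.
move=> Fcons Fbraid w u; move: {2}(size u) (erefl (size u)) => n.
elim: n w u => [|n IH] w u un v.
  by move: un => /size0nil -> [_ /= us] [_]; rewrite -us => /size0nil ->.
case: u un => // s u [un] ru; case: v => [|t v] rv.
  by have := ru.2; rewrite -rv.2.
have tail r u' : reduced_expr C w (r :: u') ->
    reduced_expr C (g r * w)%g u' /\ ell (g r * w)%g < ell w.
  case=> uE us; have := @reduced_behead r u'; rewrite uE => /(_ (conj uE us)) [_ u's].
  have -> : (g r * w = ev u')%g by rewrite -uE /= genK.
  by rewrite -us; split; [split|rewrite /= u's].
have [rsu sw] := tail _ _ ru; have [rtv tw] := tail _ _ rv.
have [st|nst] := pselect (s = t).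
  by rewrite -st in rtv *; apply/Fcons/(IH _ _ un _ rsu).
have [m0 [x [wE wl]]] := two_descents nst sw tw.
have [z [zE zs]] := reduced_exists C x.
have red p q : w = (ev (alt p q (cox_m C s t)) * x)%g -> ell (g p * w)%g < ell w ->
    reduced_expr C (g p * w)%g (alt q p (cox_m C s t).-1 ++ z).
  move=> e lt; split.
    by rewrite word_prod_cat zE e; case: (cox_m C s t) m0 => //= m _; rewrite mulgA genK.
  by rewrite size_cat size_alt zs; have := len_down lt; lia.
have altE p q : p :: alt q p (cox_m C s t).-1 ++ z = alt p q (cox_m C s t) ++ z.
  by case: (cox_m C s t) m0.
transitivity (F (alt s t (cox_m C s t) ++ z)).
  by rewrite -altE; apply/Fcons/(IH _ _ un _ rsu)/red.
rewrite Fbraid // -altE; apply/Fcons/esym/(IH _ _ _ _ rtv).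
  by have := len_down tw; have := len_down sw; rewrite -rsu.2 -rtv.2; lia.
by apply: red => //; rewrite -braid.
Qed.

End Parabolic.

(** * Demazure operators *)

(* [R] stands for Sym(V), generated by [iota V] over the scalars [cst k], and [A]
   for the action of [W] on it. *)
Section DemazureRing.
Context {W : groupType} {S : choiceType} {C : coxeterSystem W S}.
Context {k : fieldType} {V : vectType k} (r : realization C V).
Context {R : idomainType} (iota : V -> R) (cst : {rmorphism k -> R}).
Context (A : W -> {rmorphism R -> R}) (D : S -> R -> R).
Implicit Types (w : W) (s t : S) (u : seq S) (v : V) (f h : R) (c : k).
Local Notation g := (gen C).
Local Notation ev := (word_prod (gen C)).
Local Notation ell := (len C).
Local Notation alpha s := (iota (Defs.root r s)).

Hypothesis R_ind : forall P : R -> Prop, P 1 ->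
  (forall c f h, P f -> P h -> P (cst c * f + h)) ->
  (forall v f, P f -> P (iota v * f)) -> forall f, P f.
Hypothesis A_id : forall f, A 1%g f = f.
Hypothesis A_comp : forall w w' f, A (w * w')%g f = A w (A w' f).
Hypothesis A_cst : forall w c, A w (cst c) = cst c.
Hypothesis A_iota : forall w v, A w (iota v) = iota (actV r w v).
Hypothesis A_gen : forall s v, A (g s) (iota v) = iota v - cst (coroot r s v) * alpha s.
Hypothesis A_faithful : forall w w', w <> w' -> exists f, A w f != A w' f.
Hypothesis alpha_neq0 : forall s, alpha s != 0.
Hypothesis D_spec : forall s f, alpha s * D s f = f - A (g s) f.

Lemma A_neq0 w f : f != 0 -> A w f != 0.
Proof.
apply: contraNneq => /(congr1 (A w^-1%g)).
by rewrite -A_comp mulVg A_id rmorph0 => ->.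
Qed.

Lemma D_uniq s f h : alpha s * h = f - A (g s) f -> D s f = h.
Proof. by rewrite -D_spec => /(mulfI (alpha_neq0 s)). Qed.

Lemma D_add s f h : D s (f + h) = D s f + D s h.
Proof. by apply: D_uniq; rewrite rmorphD mulrDr !D_spec; ring. Qed.

Lemma D_cst s c f : D s (cst c * f) = cst c * D s f.
Proof. by apply: D_uniq; rewrite rmorphM A_cst mulrCA D_spec; ring. Qed.

Lemma D0 s : D s 0 = 0.
Proof. by apply: D_uniq; rewrite rmorph0 subr0 mulr0. Qed.

Lemma D1 s : D s 1 = 0.
Proof. by apply: D_uniq; rewrite rmorph1 subrr mulr0. Qed.

Lemma D_iota s v f : D s (iota v * f) = A (g s) (iota v) * D s f + cst (coroot r s v) * f.
Proof.
apply: D_uniq; rewrite mulrDr mulrCA D_spec rmorphM /= !A_gen; ring.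
Qed.

Lemma D_eq0 s f : D s f = 0 <-> A (g s) f = f.
Proof.
split=> [df|sf]; last by apply: D_uniq; rewrite sf subrr mulr0.
by have := D_spec s f; rewrite df mulr0 => /esym/eqP; rewrite subr_eq0 => /eqP.
Qed.

Lemma A_D s f : A (g s) (D s f) = D s f.
Proof.
apply: (mulfI (alpha_neq0 s)); rewrite D_spec.
have := congr1 (A (g s)) (D_spec s f).
rewrite rmorphM rmorphB /= -A_comp gen2 A_id A_gen coroot_root rmorph_nat => e.
by rewrite -opprB -e; ring.
Qed.

Lemma D2 s f : D s (D s f) = 0.
Proof. by apply/D_eq0/A_D. Qed.

Definition Dword u f : R := foldr D f u.

Lemma Dword_cat u u' f : Dword (u ++ u') f = Dword u (Dword u' f).
Proof. exact: foldr_cat. Qed.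

Lemma Dword_add u f h : Dword u (f + h) = Dword u f + Dword u h.
Proof. by elim: u => //= s u ->; rewrite D_add. Qed.

Lemma Dword_cst u c f : Dword u (cst c * f) = cst c * Dword u f.
Proof. by elim: u => //= s u ->; rewrite D_cst. Qed.

Lemma Dword1 s u : Dword (s :: u) 1 = 0.
Proof. by elim: u s => [|t u IH] s; [apply: D1|rewrite /= in IH *; rewrite IH D0]. Qed.

(* Moving [v] to the left produces terms in which one letter is deleted, and the
   deletion of an inner letter gives zero since it creates a repetition. *)
Lemma Dword_alt_iota s t n v f :
  Dword (alt s t n.+2) (iota v * f) =
    iota (actV r (ev (alt s t n.+2)) v) * Dword (alt s t n.+2) f
    + cst (coroot r s (actV r (ev (alt t s n.+1)) v)) * Dword (alt t s n.+1) f
    + cst (coroot r (if odd n then s else t) v) * Dword (alt s t n.+1) f.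
Proof.
elim: n s t => [|n IH] s t.
  rewrite /= !D_iota D_add !A_iota D_cst D_iota A_iota !mulg1 -actVM; ring.
have DwordS p q m h : Dword (alt p q m.+1) h = D p (Dword (alt q p m) h) by [].
rewrite (DwordS s t n.+2 (_ * _)) IH 2!D_add D_iota 2!D_cst.
rewrite (DwordS s t n) D2 mulr0 addr0 A_iota -actVM if_neg.
by rewrite -!DwordS.
Qed.

Lemma coroot_actV_gen s t v :
  coroot r s (actV r (g t) v) = coroot r s v - coroot r t v * coroot r s (Defs.root r t) :> k.
Proof. by rewrite actV_gen linearB linearZ. Qed.

(** Two-coloured quantum numbers are the coefficients with which alternating words act on coroots.
    For n + 1 = m one of them is 0 by [qnum_m] and the other is 1 by balancedness. *)
Lemma coroot_alt s t n v :
  coroot r s (actV r (ev (alt t s n)) v) =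
    qnum (- coroot r s (Defs.root r t) : k) (- coroot r t (Defs.root r s) : k) n.+1
      * coroot r (if odd n then t else s) v
    + qnum (- coroot r s (Defs.root r t) : k) (- coroot r t (Defs.root r s) : k) n
      * coroot r (if odd n then s else t) v :> k.
Proof.
have qnumSS (x y : k) m : qnum x y m.+2 = x * qnum y x m.+1 - qnum x y m by [].
have evS p q m : actV r (ev (alt p q m.+1)) v = actV r (g p) (actV r (ev (alt q p m)) v).
  by rewrite -actVM.
elim/ltn_ind: n s t => -[|[|n]] IH s t.
- by rewrite /= actV1 mul1r mul0r addr0.
- by rewrite evS coroot_actV_gen /= actV1; ring.
rewrite evS coroot_actV_gen IH // evS coroot_actV_gen coroot_root IH; last by lia.
rewrite !qnumSS /= negbK; case: (odd n) => /=; ring.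
Qed.

Hypothesis r_balanced : balanced r.

(* The difference of the two sides commutes with multiplication by [v] up to
   the twist by the longest element of the dihedral group, because the
   correction terms agree when the realization is balanced; it also kills 1. *)
Lemma Dword_braid s t f : s <> t -> (0 < cox_m C s t)%N ->
  Dword (alt s t (cox_m C s t)) f = Dword (alt t s (cox_m C s t)) f.
Proof.
move=> nst m0; have m1 := @cox_m_off _ _ C s t nst.
have mn0 : cox_m C s t <> 0%N by move=> e; rewrite e in m0.
have [q_st q_ts] := qnum_m r nst mn0; have [b_st b_ts] := r_balanced nst mn0.
have br := braid C s t.
case: (cox_m C s t) m0 m1 q_st q_ts b_st b_ts br => [|[|n]] // _ _.
rewrite !succnK => q_st q_ts b_st b_ts br.
elim/R_ind: f => [|c f h IHf IHh|v f IH].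
- by rewrite !Dword1.
- by rewrite !Dword_add !Dword_cst IHf IHh.
rewrite !Dword_alt_iota !coroot_alt q_st q_ts b_st b_ts IH br !mul0r !add0r !mul1r.
by rewrite -!addrA; congr (_ + _); rewrite addrC /= !if_neg.
Qed.

Lemma Dword_reduced w u u' f : reduced_expr C w u -> reduced_expr C w u' ->
  Dword u f = Dword u' f.
Proof.
move=> ru ru'; suff -> : Dword u = Dword u' by [].
apply: (matsumoto _ _ ru ru') => [s x y e|s t x nst m0]; apply/funext => h.
  by rewrite /= -!/(Dword _ h) e.
by rewrite !Dword_cat Dword_braid.
Qed.

Definition Dem w f : R := Dword (xget [::] (reduced_expr C w)) f.

Lemma DemE w u f : reduced_expr C w u -> Dem w f = Dword u f.
Proof.
move=> ru; rewrite /Dem; case: xgetP => [u' _ /= ru'|/(_ u)//].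
exact: Dword_reduced ru' ru.
Qed.

Lemma Dem1 f : Dem 1%g f = f.
Proof. by rewrite (@DemE _ [::]) //; split; rewrite ?len1. Qed.

Lemma Dem_up s w f : (ell w < ell (g s * w)%g)%N -> Dem (g s * w)%g f = D s (Dem w f).
Proof.
move=> lt; have [u ru] := reduced_exists C w.
rewrite (DemE _ ru) (@DemE _ (s :: u)) //.
by case: ru => uw us; split; rewrite /= ?uw // us len_up.
Qed.

Lemma Dem_down s w f : (ell (g s * w)%g < ell w)%N -> D s (Dem w f) = 0.
Proof. by move=> lt; rewrite -(genK C s w) Dem_up ?D2 // genK. Qed.

Lemma len_ind (P : W -> Prop) : P 1%g ->
  (forall s w, (ell w < ell (g s * w)%g)%N -> P w -> P (g s * w)%g) -> forall w, P w.
Proof.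
move=> P1 PS w; apply: (@parabolic_ind _ _ C setT) => // [s a _ _|]; first exact: PS.
by apply/parabolic_word; have [u uw] := gen_generate C w; exists u.
Qed.

(** Induction on [a]: if the new letter is a descent of the product so far, [D2] kills the
    composite, and a vanishing composite stays zero. *)
Lemma DemM a b f : Dem a (Dem b f) =
  if ell (a * b)%g == (ell a + ell b)%N then Dem (a * b)%g f else 0.
Proof.
elim/len_ind: a => [|s a sa IH]; first by rewrite Dem1 len1 mul1g eqxx.
have sab : (g s * a * b = g s * (a * b))%g by rewrite mulgA.
rewrite Dem_up // IH (len_up sa) sab; have := lenM C a b.
have := len_genE C s (a * b)%g; case: ifP => [lt e|/negbT ge e] le; case: eqP => ab.
- by rewrite Dem_up // e ab eqxx.
- by rewrite D0 e ifN // addSn eqSS; apply/eqP.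
- by rewrite Dem_down ?ifN //; [lia|apply/eqP; lia].
- by rewrite D0 ifN //; apply/eqP; lia.
Qed.

(* Clearing denominators in the expansion of [Dem w] in the twisted group
   algebra over the fraction field. *)
Lemma Dem_triangular w : exists (a b : R) (l : seq (R * W)),
  [/\ a != 0, b != 0, all (fun p => ell p.2 < ell w)%N l &
  forall f, a * Dem w f = b * A w f + \sum_(p <- l) p.1 * A p.2 f].
Proof.
elim/len_ind: w => [|s w lt [a [b [l [a0 b0 lw H]]]]].
  exists 1, 1, [::]; split; rewrite ?oner_neq0 // => f.
  by rewrite Dem1 A_id big_nil addr0.
pose As := A (g s).
(* D_s T is (T - s T) / alpha_s. The denominators of T and s T are [a] and [As a], and the new
   leading term comes from s T. *)
exists (alpha s * (a * As a)), (- (a * As b)),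
  ((As a * b, w) :: [seq (As a * p.1, p.2) | p <- l] ++ [seq (- (a * As p.1), (g s * p.2)%g) | p <- l]).
split.
- by rewrite !mulf_neq0 ?alpha_neq0 ?A_neq0.
- by rewrite oppr_eq0 mulf_neq0 ?A_neq0.
- rewrite /= lt all_cat !all_map /=; apply/andP; split; apply/allP => p /(allP lw) /= pw.
    exact: ltn_trans lt.
  by apply: leq_ltn_trans (lenM C (g s) p.2) _; rewrite len_gen (len_up lt) add1n ltnS.
move=> f; rewrite Dem_up // mulrAC D_spec.
have := congr1 As (H f); rewrite rmorphM rmorphD /= rmorphM -A_comp rmorph_sum /=.
set X := \sum_(p <- l) As _; move=> e; rewrite big_cons big_cat !big_map /=.
have -> : \sum_(p <- l) As a * p.1 * A p.2 f = As a * \sum_(p <- l) p.1 * A p.2 f.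
  by rewrite mulr_sumr; apply: eq_bigr => p _; rewrite mulrA.
have -> : \sum_(p <- l) - (a * As p.1) * A (g s * p.2)%g f = - (a * X).
  rewrite mulr_sumr -sumrN; apply: eq_bigr => p _.
  by rewrite rmorphM A_comp mulNr mulrA.
transitivity (As a * (a * Dem w f) - a * (As a * As (Dem w f))); first by rewrite /As; ring.
by rewrite H e; ring.
Qed.

(** Dedekind's argument: subtract [A x h] times the relation at f from the relation at h f. This
    removes x, and the choice of h keeps a nonzero multiple of [b] in front of [A w]. *)
Lemma A_indep w b (l : seq (R * W)) : all (fun p => p.2 != w) l ->
  (forall f, b * A w f + \sum_(p <- l) p.1 * A p.2 f = 0) -> b = 0.
Proof.
move: {2}(size l) (erefl (size l)) => n; elim: n l b => [|n IH] l b.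
  by move=> /size0nil -> _ /(_ 1); rewrite big_nil addr0 rmorph1 mulr1.
case: l => [//|[c x] l] [ln] /= /andP[/eqP xw lw] H; have [h hxw] := A_faithful xw.
pose d y := A y h - A x h.
have /IH : size [seq (p.1 * d p.2, p.2) | p <- l] = n by rewrite size_map.
move=> /(_ (b * d w)); rewrite all_map => /(_ lw) bd0.
have /eqP : b * d w = 0.
  apply: bd0 => f; have := H (h * f); have := H f; rewrite !big_cons big_map /=.
  move=> Hf Hhf; transitivity (b * A w (h * f) +
      (c * A x (h * f) + \sum_(p <- l) p.1 * A p.2 (h * f))
    - A x h * (b * A w f + (c * A x f + \sum_(p <- l) p.1 * A p.2 f))).
    rewrite !rmorphM; set X := \sum_(p <- l) p.1 * A p.2 f.
    have -> : \sum_(p <- l) p.1 * d p.2 * A p.2 f =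
        \sum_(p <- l) p.1 * A p.2 (h * f) - A x h * X.
      rewrite /X mulr_sumr -sumrB; apply: eq_bigr => p _; rewrite rmorphM /d; ring.
    by rewrite /d; ring.
  by rewrite Hf Hhf mulr0 subrr.
by rewrite mulf_eq0 subr_eq0 [A w h == _]eq_sym (negbTE hxw) orbF => /eqP.
Qed.

(* [T], after clearing denominators, does not involve the group element [w]. *)
Definition avoids w (T : R -> R) := exists (a : R) (l : seq (R * W)),
  [/\ a != 0, all (fun p => p.2 != w) l &
  forall f, a * T f = \sum_(p <- l) p.1 * A p.2 f].

Lemma avoids_sum w (I : Type) (s : seq I) (P : pred I) (T : I -> R -> R) :
  (forall i, P i -> avoids w (T i)) -> avoids w (fun f => \sum_(i <- s | P i) T i f).
Proof.
move=> TP; elim: s => [|i s [a [l [a0 lw H]]]].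
  by exists 1, [::]; split; rewrite ?oner_neq0 // => f; rewrite !big_nil mulr0.
have [Pi|nPi] := boolP (P i); last first.
  by exists a, l; split=> // f; rewrite big_cons (negbTE nPi).
have [b [m [b0 mw Hi]]] := TP i Pi.
exists (a * b), ([seq (a * p.1, p.2) | p <- m] ++ [seq (b * p.1, p.2) | p <- l]).
split; rewrite ?mulf_neq0 // ?all_cat ?all_map ?mw // => f.
have sumZ (c : R) (q : seq (R * W)) :
    \sum_(p <- [seq (c * p.1, p.2) | p <- q]) p.1 * A p.2 f = c * \sum_(p <- q) p.1 * A p.2 f.
  by rewrite big_map mulr_sumr; apply: eq_bigr => p _; rewrite mulrA.
by rewrite big_cons Pi big_cat !sumZ -Hi -H /=; ring.
Qed.

(** Among the nonzero coefficients take one whose element is longest: by triangularity that group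
    element occurs in no other summand. *)
Lemma Dem_indep n (c : 'I_n -> R) (w : 'I_n -> W) : injective w ->
  (forall f, \sum_(i < n) c i * Dem (w i) f = 0) -> forall i, c i = 0.
Proof.
move=> winj H i0; apply/eqP; apply: contraT => ci0.
have [i ci imax] := @arg_maxnP _ i0 (fun i => c i != 0) (fun i => ell (w i)) ci0.
have [a [b [l [a0 b0 lw Hw]]]] := Dem_triangular (w i).
have [a' [l' [a'0 l'w H']]] : avoids (w i) (fun f => \sum_(j < n | j != i) c j * Dem (w j) f).
  apply: avoids_sum => j ji; have [->|cj] := eqVneq (c j) 0.
    by exists 1, [::]; split; rewrite ?oner_neq0 // => f; rewrite mul0r mulr0 big_nil.
  have [aj [bj [lj [aj0 bj0 ljw Hj]]]] := Dem_triangular (w j).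
  exists aj, [seq (c j * p.1, p.2) | p <- (bj, w j) :: lj]; split=> //.
    rewrite /= (inj_eq winj) ji all_map; apply/allP => p /(allP ljw) /= pw.
    by apply: contraTneq pw => ->; rewrite -leqNgt; apply: imax.
  move=> f; rewrite mulrCA Hj big_map big_cons mulrDr mulr_sumr mulrA; congr (_ + _).
  by apply: eq_bigr => p _; rewrite mulrA.
have : a' * c i * b = 0.
  apply: (@A_indep (w i) _ ([seq (a' * c i * p.1, p.2) | p <- l] ++ [seq (a * p.1, p.2) | p <- l'])).
    rewrite all_cat !all_map /= l'w andbT; apply/allP => p /(allP lw) /= pw.
    by apply: contraTneq pw => ->; rewrite ltnn.
  move=> f; rewrite big_cat !big_map /=.
  have -> : \sum_(p <- l') a * p.1 * A p.2 f = a * \sum_(p <- l') p.1 * A p.2 f.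
    by rewrite mulr_sumr; apply: eq_bigr => p _; rewrite mulrA.
  rewrite -H'; have := H f; rewrite (bigD1 i) //= => /eqP; rewrite addr_eq0 => /eqP Hi.
  have -> : \sum_(p <- l) a' * c i * p.1 * A p.2 f = a' * c i * \sum_(p <- l) p.1 * A p.2 f.
    by rewrite mulr_sumr; apply: eq_bigr => p _; rewrite mulrA.
  rewrite addrA -(mulrA _ b) -mulrDr -Hw -[\sum_(_ < _ | _) _]opprK -Hi /=; ring.
by move/eqP; rewrite !mulf_eq0 (negbTE a'0) (negbTE ci) (negbTE b0).
Qed.

End DemazureRing.

(** * The polynomial model of Sym(V) as an instance of the abstract ring *)

Section SymDemazure.
Context {W : groupType} {S : choiceType} {C : coxeterSystem W S}.
Context {k : fieldType} {V : vectType k} (r : realization C V).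
Implicit Types (w : W) (s t : S) (u : seq S) (v : V) (f h : symalg V) (c : k).
Local Notation g := (gen C).
Local Notation ev := (word_prod (gen C)).
Local Notation ell := (len C).
Local Notation iota := (@sym_inj k V).
Local Notation D := (demazure_s r).

Lemma actV_linear w : linear (actV r w).
Proof.
have [u <-] := gen_generate C w; elim: u => [|s u IH] c x y /=; first by rewrite !actV1.
rewrite !actVM IH !actV_gen; set a := actV r _ x; set b := actV r _ y.
have -> : (coroot r s (c *: a + b) : k) = c * coroot r s a + coroot r s b := linearP _ _ _ _.
by rewrite scalerDl -scalerA scalerBr opprD addrACA.
Qed.

HB.instance Definition _ w :=
  GRing.isLinear.Build k V V _ (actV r w) (actV_linear w).

Lemma sym_inj_linear : linear iota.
Proof.
move=> c x y; rewrite /sym_inj scaler_sumr -big_split /=.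
by apply: eq_bigr => i _; rewrite linearP /= scalerDl scalerA.
Qed.

HB.instance Definition _ := GRing.isLinear.Build k V (symalg V) _ iota sym_inj_linear.

Lemma coord_vbasisE (i j : 'I_(\dim {:V})) : coord (vbasis {:V}) j (vbasis {:V})`_i = (i == j)%:R.
Proof. by rewrite coord_free ?(basis_free (vbasisP _)) // eq_sym. Qed.

Lemma sym_inj_vbasis (i : 'I_(\dim {:V})) : iota (vbasis {:V})`_i = 'X_i.
Proof.
rewrite /sym_inj (bigD1 i) //= coord_vbasisE eqxx scale1r big1 ?addr0 // => j ji.
by rewrite coord_vbasisE eq_sym (negbTE ji) scale0r.
Qed.

Lemma sym_inj_inj : injective iota.
Proof.
apply: raddf_inj => v v0; rewrite (coord_vbasis (memvf v)) big1 // => i _.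
have : (iota v)@_(U_(i)%MM) = 0 by rewrite v0 mcoeff0.
rewrite /sym_inj raddf_sum /= (bigD1 i) //= mcoeffZ mcoeffXU eqxx mulr1.
rewrite big1 ?addr0 => [->|j ji]; first by rewrite scale0r.
by rewrite mcoeffZ mcoeffXU (negbTE ji) mulr0.
Qed.

Lemma actR_inj w v : actR r w (iota v) = iota (actV r w v).
Proof.
rewrite /actR /sym_map {1}/sym_inj raddf_sum /=.
rewrite [in RHS](coord_vbasis (memvf v)) !raddf_sum /=.
apply: eq_bigr => i _; rewrite comp_mpolyZ comp_mpolyXU !linearZ /=; congr (_ *: _).
exact: nth_mktuple.
Qed.

Lemma actRM w f h : actR r w (f * h) = actR r w f * actR r w h.
Proof. exact: rmorphM. Qed.

Lemma actR1 w : actR r w 1 = 1.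
Proof. exact: comp_mpoly1. Qed.

Lemma actR_linear w : linear (actR r w).
Proof. by move=> c f h; rewrite /actR /sym_map linearP. Qed.

HB.instance Definition _ w :=
  GRing.isLinear.Build k (symalg V) (symalg V) _ (actR r w) (actR_linear w).

HB.instance Definition _ w :=
  GRing.isMonoidMorphism.Build (symalg V) (symalg V) (actR r w) (actR1 w, actRM w).

Lemma symalg_ind (P : symalg V -> Prop) : P 1 ->
  (forall c f h, P f -> P h -> P (c *: f + h)) ->
  (forall v f, P f -> P (iota v * f)) -> forall f, P f.
Proof.
move=> P1 PD PM f.
have P0 : P 0 by have := PD (-1) 1 1 P1 P1; rewrite scaleN1r addNr.
elim/mpolyind: f => // c m f _ _ Pf; apply: PD => //; suff PX h : P h -> P ('X_[m] * h) by rewrite -['X_[m]]mulr1; apply: PX.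
rewrite mpolyXE_id; move: h; apply: (big_ind (fun q => forall h, P h -> P (q * h))) => [h Ph|f1 f2 P1' P2 h Ph|i _ h Ph].
- by rewrite mul1r.
- by rewrite -mulrA; apply/P1'/P2.
elim: (m i) => [|n IH]; first by rewrite mul1r.
by rewrite exprS -mulrA -sym_inj_vbasis; apply: PM; rewrite sym_inj_vbasis.
Qed.

Lemma actR_comp w w' f : actR r (w * w')%g f = actR r w (actR r w' f).
Proof.
elim/symalg_ind: f => [|c f h IHf IHh|v f IH]; first by rewrite !actR1.
  by rewrite !linearP /= IHf IHh.
by rewrite !actRM IH !actR_inj actVM.
Qed.

Lemma actR_id f : actR r 1%g f = f.
Proof.
elim/symalg_ind: f => [|c f h IHf IHh|v f IH]; first by rewrite !actR1.
  by rewrite !linearP /= IHf IHh.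
by rewrite !actRM IH !actR_inj actV1.
Qed.

Hypothesis r_faithful : faithful_realization r.

Lemma actR_neq w w' : w <> w' -> exists f, actR r w f != actR r w' f.
Proof.
move=> ww'; apply: contrapT => /forallNP eqf; apply: ww'; apply: divg1_eq.
have /(r_faithful (w := (w'^-1 * w)%g)) : forall v, actV r (w'^-1 * w)%g v = v.
  move=> v; have /negP := eqf (iota v); rewrite negbK => /eqP.
  by rewrite !actR_inj => /sym_inj_inj e; rewrite actVM e -actVM mulVg actV1.
by move=> /(congr1 (fun x => w' * x)%g); rewrite mulVKg mulg1 => ->; rewrite mulgV.
Qed.

(** A zero root would make [s] act trivially. Faithfulness is used because in characteristic 2 the
    pairing with the coroot is 0. *)
Lemma root_neq0 s : iota (Defs.root r s) != 0.
Proof.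
apply/eqP; rewrite -[0](linear0 iota) => /sym_inj_inj r0.
have := @r_faithful (g s); move=> /(_ _)/(congr1 ell); rewrite len_gen len1.
by apply/not_implyP; split=> // v; rewrite actV_gen r0 scaler0 subr0.
Qed.

Lemma actR_gen_inj s v : actR r (g s) (iota v) = iota v - coroot r s v *: iota (Defs.root r s).
Proof. by rewrite actR_inj actV_gen linearB linearZ. Qed.

(** The default 0 of [xget] never occurs: the twisted Leibniz rule produces a quotient by induction
    on [f]. *)
Lemma demazure_sP s f : iota (Defs.root r s) * D s f = f - actR r (g s) f.
Proof.
rewrite /demazure_s; case: xgetP => [h _ //|none]; exfalso.
suff [h /none] : exists h, iota (Defs.root r s) * h = f - actR r (g s) f by [].
elim/symalg_ind: f {none} => [|c f h [f' Hf] [h' Hh]|v f [f' Hf]].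
- by exists 0; rewrite actR1 subrr mulr0.
- exists (c *: f' + h'); rewrite linearP /= mulrDr -scalerAr Hf Hh scalerBr.
  by rewrite opprD addrACA.
- exists (coroot r s v *: f + actR r (g s) (iota v) * f').
  rewrite mulrDr -scalerAr scalerAl mulrCA Hf actRM mulrBr addrA; congr (_ - _).
  by rewrite -mulrDl actR_gen_inj addrC subrK.
Qed.

Lemma actR_gen_C s v :
  actR r (g s) (iota v) = iota v - (coroot r s v)%:MP * iota (Defs.root r s).
Proof. by rewrite actR_gen_inj mul_mpolyC. Qed.

Lemma actR_C w c : actR r w c%:MP = c%:MP.
Proof. exact: comp_mpolyC. Qed.

Lemma symalg_indC (P : symalg V -> Prop) : P 1 ->
  (forall c f h, P f -> P h -> P (c%:MP * f + h)) ->
  (forall v f, P f -> P (iota v * f)) -> forall f, P f.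
Proof.
move=> P1 PD; apply: symalg_ind => // c f h Pf Ph.
by rewrite -mul_mpolyC; apply: PD.
Qed.

Lemma demazure_wordE u f : demazure_word r u f = Dword D u f.
Proof. by elim: u => [|s u IH]; [reflexivity|exact: (congr1 (D s) IH)]. Qed.

Lemma demazureE w f : demazure r w f = Dem (C := C) D w f.
Proof. exact: demazure_wordE. Qed.

Definition actR_morph w : {rmorphism symalg V -> symalg V} := actR r w.
Definition mpolyC_morph : {rmorphism k -> symalg V} := @mpolyC (\dim {:V}) k.

Lemma demazure_s_eq0 s f : D s f = 0 <-> actR r (g s) f = f.
Proof. exact: (D_eq0 (A := actR_morph) root_neq0 demazure_sP). Qed.

Lemma demazure_linear w : linear (demazure r w).
Proof.
move=> c f h; rewrite !demazureE -!mul_mpolyC.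
rewrite -(Dword_cst (cst := mpolyC_morph) (A := actR_morph) actR_C root_neq0 demazure_sP).
exact: (Dword_add (A := actR_morph) root_neq0 demazure_sP).
Qed.

Hypothesis r_balanced : balanced r.

Lemma demazure1 f : demazure r 1%g f = f.
Proof.
rewrite demazureE.
exact: (Dem1 (cst := mpolyC_morph) (A := actR_morph) symalg_indC actR_id actR_comp actR_C actR_inj actR_gen_C root_neq0 demazure_sP).
Qed.

Lemma demazure_down s w f : (ell (g s * w)%g < ell w)%N -> D s (demazure r w f) = 0.
Proof.
rewrite demazureE.
exact: (Dem_down (cst := mpolyC_morph) (A := actR_morph) symalg_indC actR_id actR_comp actR_C actR_inj actR_gen_C root_neq0 demazure_sP).
Qed.

Lemma demazureM a b f : demazure r a (demazure r b f) =
  if ell (a * b)%g == (ell a + ell b)%N then demazure r (a * b)%g f else 0.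
Proof.
rewrite !demazureE.
exact: (DemM (cst := mpolyC_morph) (A := actR_morph) symalg_indC actR_id actR_comp actR_C actR_inj actR_gen_C root_neq0 demazure_sP).
Qed.

Lemma demazure_indep n (c : 'I_n -> k) (w : 'I_n -> W) : injective w ->
  (forall f, \sum_(i < n) c i *: demazure r (w i) f = 0) -> forall i, c i = 0.
Proof.
move=> winj H i.
have : mpolyC (\dim {:V}) (c i) = 0; last by move/eqP; rewrite mpolyC_eq0 => /eqP.
move: i; apply: (Dem_indep (C := C) (cst := mpolyC_morph) (A := actR_morph) symalg_indC actR_id actR_comp actR_C actR_inj actR_gen_C actR_neq root_neq0 demazure_sP r_balanced winj).
move=> f; rewrite -[RHS](H f); apply: eq_bigr => i _.
by rewrite mul_mpolyC demazureE.
Qed.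

Lemma invariantP (I : set S) f : f \in Defs.invariant r I <-> forall s, I s -> D s f = 0.
Proof.
split=> [/asboolP If s Is|If].
  by apply/demazure_s_eq0; apply: If; apply: parabolic_gen.
apply/asboolP; apply: parabolic_ind => [|s w Is _ _ IH]; first exact: actR_id.
by rewrite actR_comp IH; apply/demazure_s_eq0/If.
Qed.

Lemma invariantS (I J : set S) f : I `<=` J -> f \in Defs.invariant r J -> f \in Defs.invariant r I.
Proof. by move=> IJ /invariantP Jf; apply/invariantP => s /IJ; apply: Jf. Qed.

Lemma demazure_invariant (I : set S) w f : lmax C I w -> demazure r w f \in Defs.invariant r I.
Proof. by move=> wI; apply/invariantP => s /wI; apply: demazure_down. Qed.

End SymDemazure.

(** * Morphisms of the nilCoxeter algebroid *)

Section LinearSpan.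
Context {k : fieldType} {E : lmodType k}.
Implicit Types (A B : set E) (e : E) (c : k).

Lemma lin_span_incl A : A `<=` lin_span A.
Proof.
move=> e Ae; exists 1%N, (fun=> 1), (fun=> e); split=> //.
by rewrite big_ord_recl big_ord0 scale1r addr0.
Qed.

Lemma lin_span0 A : lin_span A 0.
Proof. by exists 0%N, (fun=> 0), (fun=> 0); split=> [[]//|]; rewrite big_ord0. Qed.

Lemma lin_spanP A c e e' : lin_span A e -> lin_span A e' -> lin_span A (c *: e + e').
Proof.
move=> [n [d [a [aA ->]]]] [n' [d' [a' [a'A ->]]]].
exists (n + n')%N, (fun i => match fintype.split i with inl j => c * d j | inr j => d' j end),
  (fun i => match fintype.split i with inl j => a j | inr j => a' j end); split.
  by move=> i; case: (fintype.split i).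
rewrite big_split_ord /= scaler_sumr; congr (_ + _); apply: eq_bigr => i _.
  by rewrite (unsplitK (inl i)) scalerA.
by rewrite (unsplitK (inr i)).
Qed.

Lemma lin_span_sum A n (c : 'I_n -> k) (a : 'I_n -> E) :
  (forall i, lin_span A (a i)) -> lin_span A (\sum_(i < n) c i *: a i).
Proof.
move=> aA; elim/big_ind: _ => [|e e' Ae Ae'|i _]; first exact: lin_span0.
  by rewrite -[e]scale1r; apply: lin_spanP.
by rewrite -[_ *: _]addr0; apply: lin_spanP => //; apply: lin_span0.
Qed.

Lemma lin_span_sub A B : A `<=` lin_span B -> lin_span A `<=` lin_span B.
Proof. by move=> AB e [n [c [a [aA ->]]]]; apply: lin_span_sum => i; apply: AB. Qed.

End LinearSpan.

(** * Maximal coset elements under a change of parabolic subgroup *)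

Section Cosets.
Context {W : groupType} {S : choiceType} (C : coxeterSystem W S).
Implicit Types (w x y a b c : W) (s t : S) (I J K : set S).
Local Notation g := (gen C).
Local Notation ell := (len C).
Local Notation par := (parabolic C).
Local Notation long := (longest C).
Local Open Scope nat_scope.

Lemma lmaxS I J x : I `<=` J -> lmax C J x -> lmax C I x.
Proof. by move=> IJ xJ s /IJ; apply: xJ. Qed.

Lemma lminS I J x : I `<=` J -> lmin C J x -> lmin C I x.
Proof. by move=> IJ xJ s /IJ; apply: xJ. Qed.

Lemma lmax_mul I a b : lmax C I a -> ell (a * b)%g = ell a + ell b -> lmax C I (a * b)%g.
Proof.
move=> aI e s /aI lt; rewrite e mulgA; apply: leq_ltn_trans (lenM _ _ _) _.
by rewrite ltn_add2r.
Qed.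

Lemma len_longestV J x : lmax C J x^-1%g -> ell x = ell (x * (long J)^-1)%g + ell (long J).
Proof.
move=> xJ; have fJ := lmax_finitary xJ; rewrite -(lenV C x) (len_longestM fJ xJ) addnC.
by rewrite -(lenV C (_ * x^-1)%g) invgM invgK.
Qed.

Lemma lmin_longestV J x : lmax C J x^-1%g -> lmin C J (x * (long J)^-1)^-1%g.
Proof.
by move=> xJ; rewrite invgM invgK; apply: lmin_longestM => //; apply: lmax_finitary xJ.
Qed.

(** The coset W_I itself: it exhibits the Demazure generator from [K] to [I], and for [K = I] the
    identity, as coset operators. *)
Lemma dmax_longest I K : finitary C I -> K `<=` I -> dmax C I K (long I).
Proof.
move=> fI KI; split; first exact: lmax_longest.
by rewrite longestV //; apply: lmaxS KI _; apply: lmax_longest.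
Qed.

Lemma longest_lt I s : finitary C (s |` I) -> ~ I s -> ell (long I) < ell (long (s |` I)).
Proof.
move=> fsI nIs; have sub : I `<=` s |` I by move=> t; right.
have fI := finitaryS sub fsI; have wI := parabolic_longest fI.
rewrite ltnNge; apply/negP => /(longest_eq fsI (parabolicS sub wI)) e.
by apply: nIs; apply: (parabolic_desc wI); rewrite e; apply: lmax_longest => //; left.
Qed.

(** Regrouped as w_I times w_K x, the product still has additive lengths, so the descents of w_I
    survive; on the right, w_J splits off in the same way. *)
Lemma dmax_up I J K x : K `<=` I -> finitary C I -> dmax C K J x ->
  ell (long I * (long K)^-1 * x)%g = ell (long I * (long K)^-1)%g + ell x ->
  dmax C I J (long I * (long K)^-1 * x)%g.
Proof.
move=> KI fI [xK xJ] e; have fK := finitaryS KI fI; have fJ := lmax_finitary xJ.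
have eI := len_longestV (dmax_longest fI KI).2.
split.
  have := len_longestM fK xK; rewrite -{2}(longestV fK) => eK.
  rewrite -mulgA; apply: lmax_mul; first exact: lmax_longest.
  by rewrite mulgA e eK eI addnA.
have eJ := len_longestV xJ.
set z := (x * (long J)^-1)%g in eJ.
have -> : (long I * (long K)^-1 * x = (long I * (long K)^-1 * z) * long J)%g.
  by rewrite /z !mulgA mulgVK.
rewrite invgM; apply: lmax_mul; first by rewrite longestV //; apply: lmax_longest.
rewrite -invgM !lenV.
have e' : (long I * (long K)^-1 * z * long J = long I * (long K)^-1 * x)%g.
  by rewrite /z !mulgA mulgVK.
rewrite e' e eJ; have := lenM C (long I * (long K)^-1)%g z.
have := lenM C (long I * (long K)^-1 * z)%g (long J); rewrite e' e eJ; lia.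
Qed.

(* The reflection [s] omitted from [K] is the conjugate under w_I of a left
   descent of [x * w_J^-1]. *)
Lemma dmax_down I J x : dmax C I J x -> (forall s, ell (g s * x)%g < ell x -> I s) ->
  (x * (long J)^-1)%g <> 1%g ->
  exists s K u, [/\ I = s |` K, ~ K s, dmax C K J u,
    x = (long I * (long K)^-1 * u)%g & ell x = ell (long I * (long K)^-1)%g + ell u].
Proof.
move=> [xI xJ] full z1; have fI := lmax_finitary xI; have fJ := lmax_finitary xJ.
have eJ := len_longestV xJ; have zmin := lmin_longestV xJ.
set z := (x * (long J)^-1)%g in z1 eJ zmin.
have xE : x = (z * long J)%g by rewrite /z mulgVK.
have [s' s'z] := leftdesc_ex C z1.
have Is' : I s'.
  apply: full; rewrite {1}xE mulgA eJ; apply: leq_ltn_trans (lenM _ _ _) _.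
  by rewrite ltn_add2r.
have [s Is sE] := longest_conj fI Is'.
pose K := I `\ s; have KI : K `<=` I by move=> t [].
have IE : I = s |` K by rewrite setD1K.
have fK := finitaryS KI fI.
pose y := (long I * x)%g; have ymin : lmin C I y by apply: lmin_longestM.
have wIx : (long I * y = x)%g by rewrite /y mulgA longest2 ?mul1g.
have lx : ell x = ell (long I) + ell y by apply: len_longestM.
have ymin' := lminS KI ymin.
have lu : ell (long K * y)%g = ell (long K) + ell y.
  by apply: (lmin_len ymin'); apply: parabolic_longest.
exists s, K, (long K * y)%g; split=> //; first by case=> _ [].
- split; first exact: lmax_longestM.
  move=> t Jt; rewrite -(lenV C (g t * _)%g) invgM invgK genV lenV lu -mulgA.
  (* If y t stays [I]-minimal, lengths add over w_I, so t is a descent of y because it is one of x.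
     Otherwise t passes through y as [s0], which w_K absorbs unless [s0] is the omitted [s]. *)
  have [yt|[s0 Is0 ys0]] := lmin_gen t ymin.
    apply: leq_ltn_trans (lenM _ _ _) _; rewrite ltn_add2l.
    have := xJ t Jt; rewrite -(lenV C (g t * _)%g) invgM invgK genV lenV lx.
    by rewrite -{1}wIx -mulgA (lmin_len yt) ?ltn_add2l //; apply: parabolic_longest.
  have [s0s|s0s] := pselect (s0 = s); last first.
    have Ks0 : K s0 by split.
    rewrite ys0 mulgA; apply: leq_ltn_trans (lenM _ _ _) _; rewrite ltn_add2r.
    by rewrite -(lenV C (_ * _)%g) invgM genV longestV //; apply: lmax_longest.
  (* Now x t = s' x; cancelling w_J gives z t' = s' z, shorter than z, although z is minimal in z
     W_J. *)
  exfalso; have [t' Jt' t'E] := longest_conj fJ Jt.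
  have zt : (g t' * z^-1 = (z * g t')^-1)%g by rewrite [in RHS]invgM genV.
  have := zmin t' Jt'; rewrite zt !lenV.
  suff -> : (z * g t' = g s' * z)%g by rewrite ltnNge ltnW.
  have xt : (x * g t = g s' * x)%g.
    rewrite -[in LHS]wIx -mulgA ys0 s0s -sE -wIx !mulgA longest2 ?mul1g //.
  by rewrite -t'E /z longestV // !mulgA -(mulgA x (long J)) longest2 // mulg1 xt.
- by rewrite -!mulgA mulKg wIx.
by rewrite lu lx (len_longestV (dmax_longest fI KI).2) addnA.
Qed.

End Cosets.

(** * Coset operators versus composites of generators *)

Section NilCoxeter.
Context {W : groupType} {S : choiceType} {C : coxeterSystem W S}.
Context {k : fieldType} {V : vectType k} (r : realization C V).
Hypothesis r_faithful : faithful_realization r.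
Hypothesis r_balanced : balanced r.
Hypothesis r_surj : demazure_surjective r.
Implicit Types (w x y a b : W) (s t : S) (I J K : set S) (h : symalg V).
Local Notation g := (gen C).
Local Notation ell := (len C).
Local Notation long := (longest C).
Local Notation dem := (demazure r).

Lemma restricts_inj J I F (phi psi : invR r J -> invR r I) :
  restricts F phi -> restricts F psi -> phi = psi.
Proof. by move=> Fphi Fpsi; apply/funext => f; apply: val_inj; rewrite /= Fphi Fpsi. Qed.

Lemma restricts_exists J I (F : symalg V -> symalg V) :
  (forall f, f \in Defs.invariant r J -> F f \in Defs.invariant r I) ->
  exists phi : invR r J -> invR r I, restricts F phi.
Proof.
move=> FJI; have FI (f : invR r J) : F (inv_val f) \in Defs.invariant r I.
  by apply: FJI; case: f.
by exists (fun f => InvR (FI f)).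
Qed.

Lemma restricts_linear J I w (phi : invR r J -> invR r I) :
  restricts (dem w) phi -> linear phi.
Proof.
move=> wphi c f h; apply: val_inj; rewrite [LHS]wphi.
transitivity (c *: dem w (inv_val f) + dem w (inv_val h)); last by rewrite -!wphi.
exact: (demazure_linear r_faithful).
Qed.

Lemma demazure_longest_ex J f : finitary C J -> f \in Defs.invariant r J ->
  exists h, dem (long J) h = f.
Proof. by move=> fJ; apply: r_surj. Qed.

Lemma demazure_dmax I J x h : dmax C I J x ->
  dem (x * (long J)^-1)%g (dem (long J) h) = dem x h.
Proof.
move=> [_ xJ]; rewrite (demazureM r_faithful r_balanced) mulgVK.
by rewrite -len_longestV // eqxx.
Qed.

Lemma dmax_restricts I J x : dmax C I J x ->
  exists phi : invR r J -> invR r I, restricts (dem (x * (long J)^-1)%g) phi.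
Proof.
move=> xIJ; apply: restricts_exists => f.
move=> /(demazure_longest_ex (lmax_finitary xIJ.2))[h <-].
rewrite (demazure_dmax _ xIJ).
exact: (demazure_invariant r_faithful r_balanced) xIJ.1.
Qed.

Definition is_coset_hom J I (phi : invR r J -> invR r I) :=
  exists2 x, dmax C I J x & restricts (dem (x * (long J)^-1)%g) phi.

Lemma coset_hom_id J : finitary C J -> is_coset_hom (@idfun (invR r J)).
Proof.
move=> fJ; exists (long J); first exact: dmax_longest.
by move=> f; rewrite mulgV (demazure1 r_faithful r_balanced).
Qed.

Lemma elementary_coset_hom J K I (phi : invR r J -> invR r K) (psi : invR r K -> invR r I) :
  is_coset_hom phi -> elementary psi ->
  (forall f, (psi \o phi) f = 0) \/ is_coset_hom (psi \o phi).
Proof.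
move=> [x xKJ xphi] psiE; have fJ := lmax_finitary xKJ.2.
case: psiE phi xphi xKJ => {K I psi} [I s psi nIs fsI ipsi|K s psi nKs fsK dpsi] phi xphi xKJ.
  right; exists x; first by split; [apply: lmaxS xKJ.1 => t; right|exact: xKJ.2].
  by move=> f; rewrite /= ipsi -xphi.
have KI : K `<=` s |` K by move=> t; right.
have comp f h : inv_val f = dem (long J) h ->
    inv_val ((psi \o phi) f) = dem (long (s |` K) * (long K)^-1)%g (dem x h).
  by move=> fh; rewrite /= dpsi xphi fh (demazure_dmax _ xKJ).
case: (eqVneq (ell (long (s |` K) * (long K)^-1 * x)%g)
  (ell (long (s |` K) * (long K)^-1)%g + ell x)%N) => [add|nadd].
  have ux := dmax_up KI fsK xKJ add.
  right; exists (long (s |` K) * (long K)^-1 * x)%g => // f.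
  have [h fh] := demazure_longest_ex fJ (valP f).
  by rewrite (comp f h) // -[inv_val f]fh (demazure_dmax _ ux) (demazureM r_faithful r_balanced) add eqxx.
left=> f; have [h fh] := demazure_longest_ex fJ (valP f).
apply: val_inj; rewrite [LHS](comp f h) // (demazureM r_faithful r_balanced).
by rewrite (negbTE nadd).
Qed.

Lemma elementary_restricts K I (psi : invR r K -> invR r I) :
  elementary psi -> exists w, restricts (dem w) psi.
Proof.
case=> {K I psi} [I s psi _ _ ipsi|K s psi _ _ dpsi]; last by eexists; exact: dpsi.
by exists 1%g => f; rewrite (demazure1 r_faithful r_balanced).
Qed.

Lemma elementary_comp_coset_hom J I (phi : invR r J -> invR r I) : finitary C J ->
  elementary_comp phi -> (forall f, phi f = 0) \/ is_coset_hom phi.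
Proof.
move=> fJ; elim=> [|K {}I {}phi psi _ [phi0|phiC] psiE]; first by right; apply: coset_hom_id.
  left=> f; have [w wpsi] := elementary_restricts psiE.
  by have := restricts_linear wpsi (-1) 0 0; rewrite /= phi0 !scaleN1r !addNr.
exact: elementary_coset_hom phiC psiE.
Qed.

(** Lexicographic induction: [n] bounds the length of x w_J^-1 and [m] the excess of x over w_I.
    Enlarging [I] keeps x and lowers [m]; splitting off the factor w_I w_K^-1 lowers [n]. *)
Lemma coset_hom_elementary_comp J I (phi : invR r J -> invR r I) :
  is_coset_hom phi -> elementary_comp phi.
Proof.
suff H n m I' x : (ell (x * (long J)^-1)%g <= n)%N -> (ell x - ell (long I') <= m)%N ->
    dmax C I' J x ->
    exists2 psi : invR r J -> invR r I', restricts (dem (x * (long J)^-1)%g) psi & elementary_comp psi.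
  case=> x xIJ xphi; have [psi xpsi psiE] := H _ _ _ _ (leqnn _) (leqnn _) xIJ.
  by rewrite (restricts_inj xphi xpsi).
clear phi I; elim/ltn_ind: n m I' x => n IHn; elim/ltn_ind=> m IHm I x ln lm xIJ.
have [xI xJ] := xIJ; have fI := lmax_finitary xI; have fJ := lmax_finitary xJ.
have [[s nIs sx]|full] := pselect (exists2 s, ~ I s & (ell (g s * x)%g < ell x)%N).
  have xsI : lmax C (s |` I) x by move=> t [->|/xI].
  have fsI := lmax_finitary xsI.
  have lt := longest_lt fsI nIs; have le := len_longestM fsI xsI.
  have [||psi xpsi psiE] := IHm (m.-1) _ (s |` I) x ln _ (conj xsI xJ).
    by lia.
    by lia.
  have [incl inclE] : exists incl : invR r (s |` I) -> invR r I, restricts idfun incl.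
    by apply: restricts_exists => f; apply: (invariantS r_faithful) => t; right.
  exists (incl \o psi); first by move=> f; rewrite /= inclE -xpsi.
  by apply: ecomp_step psiE _; apply: elem_incl inclE.
have {}full s : (ell (g s * x)%g < ell x)%N -> I s.
  by move=> sx; apply: contrapT => nIs; apply: full; exists s.
have [z1|z1] := pselect ((x * (long J)^-1)%g = 1%g).
  (* Here x = w_J has left descent set [J], so [I = J] and the operator is the identity. *)
  have xE := divg1_eq z1; subst x.
  have -> : I = J.
    apply/seteqP; split=> s; first by move=> /xI; apply: parabolic_desc; apply: parabolic_longest.
    by move=> Js; apply: full; apply: lmax_longest.
  exists idfun; last exact: ecomp_id.
  by move=> f; rewrite mulgV (demazure1 r_faithful r_balanced).
have [s [K [u [IE nKs uKJ xE lx]]]] := dmax_down xIJ full z1.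
subst I; have KI : K `<=` s |` K by move=> t; right.
have [//|psi upsi psiE] := IHn (ell (u * (long J)^-1)%g) _ _ K u (leqnn _) (leqnn _) uKJ.
  by have := len_longestV xJ; have := len_longestV uKJ.2; have := longest_lt fI nKs; have := len_longestV (dmax_longest fI KI).2; lia.
have [eta etaE] := dmax_restricts (dmax_longest fI KI).
exists (eta \o psi); last by apply: ecomp_step psiE _; apply: elem_demazure etaE.
move=> f; rewrite /= etaE upsi.
have [h fh] := demazure_longest_ex fJ (valP f).
rewrite -[inv_val f]fh (demazure_dmax _ uKJ) (demazure_dmax _ xIJ).
by rewrite (demazureM r_faithful r_balanced) -xE lx eqxx.
Qed.

End NilCoxeter.

(** * Hom-spaces as spans, composition and bases *)

Section NilCoxeterHoms.
Context {W : groupType} {S : choiceType} {C : coxeterSystem W S}.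
Context {k : fieldType} {V : vectType k} (r : realization C V).
Hypothesis r_faithful : faithful_realization r.
Hypothesis r_balanced : balanced r.
Hypothesis r_surj : demazure_surjective r.
Implicit Types (x w : W) (I J K : set S) (p : set W).

Lemma is_coset_homP I J (phi : invR r J -> invR r I) : finitary C I -> finitary C J ->
  is_coset_hom phi <->
  exists2 p, double_cosets C I J p & restricts (demazure_coset r J p) phi.
Proof.
move=> fI fJ; split=> [[x xIJ xphi]|[p pIJ pphi]].
  exists (double_coset C I x J); first by exists x.
  by rewrite /demazure_coset (coset_max_dmax xIJ).
have [x xIJ pE] := double_cosets_dmax fI fJ pIJ; exists x => //.
by move: pphi; rewrite /demazure_coset pE (coset_max_dmax xIJ).
Qed.

Lemma lin_span_linear I J (A : set (invR r J -> invR r I)) phi :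
  (forall psi, A psi -> linear psi) -> lin_span A phi -> linear phi.
Proof.
move=> Alin [n [c [a [aA ->]]]] d f h; rewrite !fct_sumE scaler_sumr -big_split /=.
apply: eq_bigr => i _; rewrite /= !scalrfctE (Alin _ (aA i)) scalerDr.
by rewrite !scalerA [d * _]mulrC.
Qed.

Lemma coset_hom_linear I J (phi : invR r J -> invR r I) : is_coset_hom phi -> linear phi.
Proof. by case=> x _; apply: restricts_linear. Qed.

Lemma elementary_comp_linear I J (phi : invR r J -> invR r I) : finitary C J ->
  elementary_comp phi -> linear phi.
Proof.
move=> fJ /(elementary_comp_coset_hom r_faithful r_balanced r_surj fJ)[phi0 c f h|].
  by rewrite !phi0 scaler0 addr0.
exact: coset_hom_linear.
Qed.

Lemma nilCoxeter_homE I J : finitary C I -> finitary C J ->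
  nilCoxeter_hom r J I = nilCoxeter'_hom r J I.
Proof.
move=> fI fJ; apply/seteqP; split; apply: lin_span_sub => phi.
  move=> /(is_coset_homP _ fI fJ)/(coset_hom_elementary_comp r_faithful r_balanced r_surj).
  exact: lin_span_incl.
move=> /(elementary_comp_coset_hom r_faithful r_balanced r_surj fJ)[phi0|phiC].
  have -> : phi = 0 by apply/funext.
  exact: lin_span0.
by apply: lin_span_incl; apply/is_coset_homP.
Qed.

Lemma elementary_comp_comp I J K (phi : invR r K -> invR r J) (psi : invR r J -> invR r I) :
  elementary_comp phi -> elementary_comp psi -> elementary_comp (psi \o phi).
Proof.
move=> phiE; elim=> [//|L L' psi1 psi2 _ IH psi2E].
exact: ecomp_step IH psi2E.
Qed.

(** Distributing over the inner sum uses linearity of the outer composites. *)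
Lemma nilCoxeter'_hom_comp I J K (phi : invR r K -> invR r J) (psi : invR r J -> invR r I) :
  finitary C J -> nilCoxeter'_hom r K J phi -> nilCoxeter'_hom r J I psi ->
  nilCoxeter'_hom r K I (psi \o phi).
Proof.
move=> fJ [n [c [a [aE ->]]]] [m [d [b [bE ->]]]].
have -> : (\sum_(j < m) d j *: b j) \o (\sum_(i < n) c i *: a i) =
    \sum_(j < m) d j *: \sum_(i < n) c i *: (b j \o a i).
  apply/funext => f; rewrite /= !fct_sumE; apply: eq_bigr => j _.
  pose bj : {linear invR r J -> invR r I} :=
    HB.pack (b j) (GRing.isLinear.Build k _ _ _ (b j) (elementary_comp_linear fJ (bE j))).
  rewrite !scalrfctE fct_sumE -[b j _]/(bj _) linear_sum; congr (_ *: _).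
  by apply: eq_bigr => i _; rewrite !scalrfctE linearZ.
apply: lin_span_sum => j; apply: lin_span_sum => i; apply: lin_span_incl.
exact: elementary_comp_comp (aE i) (bE j).
Qed.

Lemma coset_hom_free I J (b : set W -> (invR r J -> invR r I)) :
  finitary C I -> finitary C J ->
  (forall p, double_cosets C I J p -> restricts (demazure_coset r J p) (b p)) ->
  lin_free (double_cosets C I J) b.
Proof.
move=> fI fJ bP n p c pinj pP sum0.
have /choice[x xP] i : exists x, dmax C I J x /\ p i = double_coset C I x J.
  by have [x] := double_cosets_dmax fI fJ (pP i); exists x.
have xinj : injective x.
  by move=> i j xij; apply: pinj; rewrite (xP i).2 (xP j).2 xij.
apply: (demazure_indep r_faithful r_balanced xinj) => h.
have hJ : demazure r (longest C J) h \in Defs.invariant r J.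
  exact: (demazure_invariant r_faithful r_balanced) (lmax_longest fJ).
have e : inv_val ((\sum_(i < n) c i *: b (p i)) (InvR hJ)) = 0 by rewrite sum0.
rewrite -[RHS]e fct_sumE [RHS](raddf_sum val); apply: eq_bigr => i _.
rewrite !scalrfctE [RHS](linearZ_LR val) /= bP ?pP // /demazure_coset (xP i).2.
by rewrite (coset_max_dmax (xP i).1) (demazure_dmax r_faithful r_balanced _ (xP i).1).
Qed.

Lemma coset_hom_exists I J : finitary C I -> finitary C J ->
  exists b : set W -> (invR r J -> invR r I),
    forall p, double_cosets C I J p -> restricts (demazure_coset r J p) (b p).
Proof.
move=> fI fJ; suff ex p : exists phi : invR r J -> invR r I,
    double_cosets C I J p -> restricts (demazure_coset r J p) phi.
  by have [b bP] := choice ex; exists b.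
(* The value 0 away from the double cosets is a dummy. *)
have [pIJ|npIJ] := pselect (double_cosets C I J p); last by exists 0.
have [x xIJ pE] := double_cosets_dmax fI fJ pIJ.
have [phi xphi] := dmax_restricts r_faithful r_balanced r_surj xIJ.
by exists phi => _; rewrite /demazure_coset pE (coset_max_dmax xIJ).
Qed.

End NilCoxeterHoms.

Theorem corollary3p20 (W : groupType) (S : choiceType) (C : coxeterSystem W S)
    (k : fieldType) (V : vectType k) (r : realization C V)
    (r_faithful : faithful_realization r) (r_balanced : balanced r)
    (r_surj : demazure_surjective r) :
  (forall I J : set S, finitary C I -> finitary C J ->
     nilCoxeter_hom r J I = nilCoxeter'_hom r J I) /\
  (forall I J (phi : invR r J -> invR r I), finitary C I -> finitary C J ->
     nilCoxeter_hom r J I phi -> linear phi) /\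
  (forall I : set S, finitary C I -> nilCoxeter_hom r I I idfun) /\
  (forall I J K (phi : invR r K -> invR r J) (psi : invR r J -> invR r I),
     finitary C I -> finitary C J -> finitary C K ->
     nilCoxeter_hom r K J phi -> nilCoxeter_hom r J I psi ->
     nilCoxeter_hom r K I (psi \o phi)) /\
  (forall I J : set S, finitary C I -> finitary C J ->
     exists b : set W -> (invR r J -> invR r I),
       (forall p, double_cosets C I J p ->
          restricts (demazure_coset r J p) (b p)) /\
       is_basis (double_cosets C I J) b (nilCoxeter_hom r J I)).
Proof.
have homE := nilCoxeter_homE r_faithful r_balanced r_surj.
split; first exact: homE.
split.
  move=> I J phi fI fJ; apply: lin_span_linear => psi /(is_coset_homP _ fI fJ).
  exact: coset_hom_linear.
split.
  move=> I fI; apply: lin_span_incl; apply/(is_coset_homP _ fI fI).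
  exact: coset_hom_id.
split.
  (* Closure is transported from the other category, whose generating composites are closed under
     composition. *)
  move=> I J K phi psi fI fJ fK; rewrite !homE // => phiK psiJ.
  exact: nilCoxeter'_hom_comp phiK psiJ.
move=> I J fI fJ; have [b bP] := coset_hom_exists r_faithful r_balanced r_surj fI fJ.
exists b; split=> //; split; first exact: coset_hom_free.
(* An operator has at most one restriction, so the image of [b] is the whole spanning set. *)
rewrite /nilCoxeter_hom; congr lin_span; apply/seteqP; split=> phi.
  by move=> [p pIJ <-]; exists p => //; apply: bP.
by move=> [p pIJ pphi]; exists p => //; apply: restricts_inj (bP p pIJ) pphi.
Qed.
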